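(* Let $G=(V,E)$ be a graph, $R$ a multiset of vertices of $V$, and $b^\circ:R\to Gr(2,\mathbb{R}^3)$, $r\mapsto[b^\circ_r]$. Suppose $b^\circ(R)$ is in general position. Then there exists $\tilde p:V\to\mathbb{P}^2$ such that $(G,R;\tilde p,b^\circ)$ is a minimally infinitesimally rigid bar-joint framework with bar-boundary (in the projective plane) if and only if (1) $|R_v|\le 2$ and $\{b^\circ_r\mid r\in R_v\}$ is linearly independent for each $v\in V$; (2) $|F|+|R_F|\le 2|V(F)|-3+\dim(\{b^\circ_r\mid r\in R_F\})$ for every non-empty $F\subseteq E$; (3) $|E|+|R|=2|V|$.
   Context: Graphs are finite and undirected; $V(F)$ is the set of vertices incident to edges of $F\subseteq E$. The multiset $R$ is an indexed family of vertices (elements with different indices are different elements of $R$); $R_v=\{r\in R\mid r=v\}$ and $R_F=\{r\in R\mid r\in V(F)\}$ as multi-subsets. $\dim(\cdot)$ of a family of vectors is the dimension of its linear span. $Gr(2,\mathbb{R}^3)$ is the set of $2$-dimensional linear subspaces of $\mathbb{R}^3$, i.e. of projective lines in $\mathbb{P}^2$, identified via the Plücker embedding with classes $[v_1\wedge v_2]\in\mathbb{P}(\bigwedge^2\mathbb{R}^3)$ of nonzero decomposable elements; $b^\circ_r$ is a representative vector. A finite set of projective lines is in general position if no three lines of the set intersect at a point. For $a\in\mathbb{R}^3$ and $c\in\bigwedge^2\mathbb{R}^3$, $\langle a,c\rangle$ denotes the standard Euclidean inner product $\langle a,*c\rangle$ of $a$ with the Hodge dual of $c$; for a point $[a]$ and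 a line $[c]$, $\langle a,c\rangle=0$ means the point lies on the line. A 2-dimensional bar-joint framework with bar-boundary in the projective plane is a tuple $(G,R;\tilde p,b^\circ)$ where $\tilde p:V\to\mathbb{P}^2$, $v\mapsto[\tilde p_v]$, is injective and $b^\circ:R\to Gr(2,\mathbb{R}^3)$ satisfies $\langle\tilde p_v,b^\circ_r\rangle=0$ whenever $r\in R_v$. Let $b_{uv}=\tilde p_u\wedge\tilde p_v$ for $uv\in E$. An infinitesimal motion of the derived body-bar framework $(G,R;b,b^\circ)$ is a map $m:V\to\mathbb{R}^3$ with $\langle m(u)-m(v),b_e\rangle=0$ for all $e=uv\in E$ and $\langle m(v),b^\circ_r\rangle=0$ for all $v\in V$, $r\in R_v$. For $v\in V$ the trivial dangling around $v$ is the motion $m_v$ with $m_v(v)=\tilde p_v$ and $m_v(u)=0$ for $u\ne v$. The framework $(G,R;\tilde p,b^\circ)$ is infinitesimally rigid if every infinitesimal motion of $(G,R;b,b^\circ)$ is a linear combination of trivial danglings; it is minimally infinitesimally rigid if moreover removing any bar (an edge of $E$ or a boundary-bar, i.e. an element of $R$) results in a framework that is not infinitesimally rigid. *)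

(* Defs.v *)
From mathcomp Require Import all_boot all_order all_algebra.
From mathcomp Require Import reals.

Set Implicit Arguments.
Unset Strict Implicit.
Unset Printing Implicit Defensive.

Import Order.TTheory GRing.Theory Num.Theory.
Local Open Scope ring_scope.

Section Plucker.
Variable R : realType.

(* A vector c of 'rV[R]_3 playing the role of a bivector stands for
   c_0 e_1/\e_2 + c_1 e_1/\e_3 + c_2 e_2/\e_3. *)
Definition wedge (x y : 'rV[R]_3) : 'rV[R]_3 :=
  \row_(k < 3) [:: x 0 0 * y 0 1 - x 0 1 * y 0 0;
                   x 0 0 * y 0 2 - x 0 2 * y 0 0;
                   x 0 1 * y 0 2 - x 0 2 * y 0 1]`_k.

(* *(e_1/\e_2) = e_3, *(e_1/\e_3) = - e_2, *(e_2/\e_3) = e_1 *)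
Definition hodge (c : 'rV[R]_3) : 'rV[R]_3 :=
  \row_(k < 3) [:: c 0 2; - c 0 1; c 0 0]`_k.

Definition pairing (a c : 'rV[R]_3) : R := \sum_(k < 3) a 0 k * hodge c 0 k.

(* c represents a projective line, i.e. [c] is the Plucker image of an element
   of Gr(2, R^3). *)
Definition represents_line (c : 'rV[R]_3) : Prop :=
  c != 0 /\ exists x y : 'rV[R]_3, c = wedge x y.

(* No three lines of the indexed family b pass through a common point. The
   indices, not the lines, are required to be distinct: a line occurring at two
   indices counts twice, just as in the linear independence of the b r. If
   repeated lines were counted once, two vertices u and v could carry the same
   two lines L and M, which forces p u and p v to be the same point. *)
Definition general_position (I : finType) (b : I -> 'rV[R]_3) : Prop :=
  forall r s t : I, uniq [:: r; s; t] ->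
    ~ exists a : 'rV[R]_3,
        [/\ a != 0, pairing a (b r) = 0, pairing a (b s) = 0
          & pairing a (b t) = 0].

End Plucker.

(* Edge e joins the two vertices of the pair ends e; the order within the pair
   is immaterial below, and parallel edges and loops are allowed. The multiset
   of vertices is the family at_ : I -> V. *)
Section Graph.
Variables (V E I : finType) (ends : E -> V * V) (at_ : I -> V).

Definition edge_verts (F : {set E}) : {set V} :=
  [set v | [exists e in F, (v == (ends e).1) || (v == (ends e).2)]].

Definition boundary_at (v : V) : {set I} := [set r | at_ r == v].

Definition boundary_of (F : {set E}) : {set I} :=
  [set r | at_ r \in edge_verts F].

End Graph.

Section Framework.
Variables (R : realType) (V E I : finType) (ends : E -> V * V) (at_ : I -> V).
Variables (p : V -> 'rV[R]_3) (b : I -> 'rV[R]_3).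

(* A point of the projective plane is the line <[x]> spanned by some x != 0. *)
Definition bar_joint_framework : Prop :=
  [/\ forall v, p v != 0,
      injective (fun v => <[p v]>%VS),
      forall r, represents_line (b r)
    & forall v r, r \in boundary_at at_ v -> pairing (p v) (b r) = 0].

Definition bar (e : E) : 'rV[R]_3 := wedge (p (ends e).1) (p (ends e).2).

(* Below F and S are the sets of edges and of boundary-bars that are kept. *)
Definition infinitesimal_motion (F : {set E}) (S : {set I})
    (m : V -> 'rV[R]_3) : Prop :=
  (forall e, e \in F -> pairing (m (ends e).1 - m (ends e).2) (bar e) = 0) /\
  (forall v r, r \in boundary_at at_ v -> r \in S -> pairing (m v) (b r) = 0).

Definition trivial_dangling (v : V) : V -> 'rV[R]_3 :=
  fun u => if u == v then p v else 0.

Definition infinitesimally_rigid (F : {set E}) (S : {set I}) : Prop :=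
  forall m, infinitesimal_motion F S m ->
    exists c : V -> R, forall u, m u = \sum_v c v *: trivial_dangling v u.

Definition minimally_infinitesimally_rigid : Prop :=
  [/\ infinitesimally_rigid setT setT,
      forall e : E, ~ infinitesimally_rigid [set~ e] setT
    & forall r : I, ~ infinitesimally_rigid setT [set~ r]].

End Framework.

(* Main.v *)
Require Import Defs.
From mathcomp Require Import all_boot all_order all_algebra.
From mathcomp Require Import boolp reals.
From mathcomp Require Import ring lra zify.

(** A bar through [x] and [y] acts on a motion as the cross product of [x] and
    [y], and a boundary bar on the line [b r] as [hodge (b r)].

    Necessity: minimal rigidity provides for every bar a motion of the framework
    without it on which it does not vanish. These motions are linearly
    independent modulo every space killed by the bars considered; for the bars
    of [F] and [R_F] such a space consists of the danglings and of the rotations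
    common to [V(F)] that are orthogonal to all lines of [R_F].

    Sufficiency: by Henneberg induction. Since the boundary is nonempty, the
    average of [deg v + 2 |R_v|] being 4 yields a vertex with [(deg v, |R_v|)]
    among (0,2), (1,1), (2,0), (2,1), (3,0). In the first three cases it is
    deleted. In case (3,0) an edge between two of its neighbours is added, and
    the vertex is put back on that edge; in case (2,1) its line is handed over to
    one of its neighbours, and the vertex is put back on that line. Rigidity is a
    Zariski-open condition on the placement of the points on their lines, so the
    points may always be assumed to be generic subject to their lines, and general
    position provides the noncollinearities required. *)

Set Implicit Arguments.
Unset Strict Implicit.
Unset Printing Implicit Defensive.

Import Order.TTheory GRing.Theory Num.Theory.
Local Open Scope ring_scope.

(** * Cross products in three-space *)

Section CrossProduct.
Variable R : realFieldType.
Implicit Types a x y z l m n : 'rV[R]_3.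

Definition dot x y : R := x 0 0 * y 0 0 + x 0 1 * y 0 1 + x 0 2 * y 0 2.

Definition cross x y : 'rV[R]_3 :=
  \row_(k < 3) [:: x 0 1 * y 0 2 - x 0 2 * y 0 1;
                   x 0 2 * y 0 0 - x 0 0 * y 0 2;
                   x 0 0 * y 0 1 - x 0 1 * y 0 0]`_k.

Lemma row3P x y :
  x 0 0 = y 0 0 -> x 0 1 = y 0 1 -> x 0 2 = y 0 2 -> x = y.
Proof.
move=> e0 e1 e2; apply/rowP=> -[[|[|[|//]]] lti].
- by rewrite (_ : Ordinal _ = 0) //; apply/val_inj.
- by rewrite (_ : Ordinal _ = 1) //; apply/val_inj.
- by rewrite (_ : Ordinal _ = 2) //; apply/val_inj.
Qed.

Lemma dotC x y : dot x y = dot y x.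
Proof. by rewrite /dot; ring. Qed.

Lemma dotDl x y z : dot (x + y) z = dot x z + dot y z.
Proof. by rewrite /dot !mxE; ring. Qed.

Lemma dotZl k x z : dot (k *: x) z = k * dot x z.
Proof. by rewrite /dot !mxE; ring. Qed.

Lemma dotNl x z : dot (- x) z = - dot x z.
Proof. by rewrite /dot !mxE; ring. Qed.

Lemma dot0l x : dot 0 x = 0.
Proof. by rewrite /dot !mxE; ring. Qed.

Lemma dotBl x y z : dot (x - y) z = dot x z - dot y z.
Proof. by rewrite dotDl dotNl. Qed.

Lemma dot_eq0 x : (dot x x == 0) = (x == 0).
Proof.
apply/eqP/eqP=> [|->]; last by rewrite dot0l.
rewrite /dot => dxx0.
have [] : x 0 0 = 0 /\ x 0 1 = 0 /\ x 0 2 = 0 by repeat split; nra.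
by move=> x0 [x1 x2]; apply: row3P; rewrite mxE.
Qed.

Lemma cross_self x : cross x x = 0.
Proof. by apply: row3P; rewrite !mxE /=; ring. Qed.

Lemma crossC x y : cross x y = - cross y x.
Proof. by apply: row3P; rewrite !mxE /=; ring. Qed.

Lemma crossDl x y z : cross (x + y) z = cross x z + cross y z.
Proof. by apply: row3P; rewrite !mxE /=; ring. Qed.

Lemma crossZl k x z : cross (k *: x) z = k *: cross x z.
Proof. by apply: row3P; rewrite !mxE /=; ring. Qed.

Lemma cross0l x : cross 0 x = 0.
Proof. by apply: row3P; rewrite !mxE /=; ring. Qed.

Lemma cross_eq0C x y : (cross x y == 0) = (cross y x == 0).
Proof. by rewrite crossC oppr_eq0. Qed.

Lemma dot_crossl x y : dot x (cross x y) = 0.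
Proof. by rewrite /dot !mxE /=; ring. Qed.

Lemma dot_crossr x y : dot y (cross x y) = 0.
Proof. by rewrite /dot !mxE /=; ring. Qed.

Lemma dot_cross_rot x y z : dot x (cross y z) = dot y (cross z x).
Proof. by rewrite /dot !mxE /=; ring. Qed.

Lemma cross_crossl x y z :
  cross (cross x y) z = dot x z *: y - dot y z *: x.
Proof. by apply: row3P; rewrite /dot !mxE /=; ring. Qed.

Lemma cross_crossr x y z :
  cross x (cross y z) = dot x z *: y - dot x y *: z.
Proof. by apply: row3P; rewrite /dot !mxE /=; ring. Qed.

(** [cross y (cross x y)] expands to [dot y y *: x - dot y x *: y], and [dot y y] can be divided out
    because the form is definite. *)
Lemma cross0_scale x y : y != 0 -> cross x y = 0 ->
  x = (dot x y / dot y y) *: y.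
Proof.
rewrite -dot_eq0 => dy0 cxy.
have /eqP := cross_crossr y x y; rewrite cxy crossC cross0l oppr0 eq_sym subr_eq0.
move=> /eqP /(congr1 (fun u => (dot y y)^-1 *: u)).
by rewrite !scalerA mulVf // scale1r mulrC dotC.
Qed.

Lemma dot_cross0r a x y : cross a y = 0 -> dot a (cross x y) = 0.
Proof. by move=> cay; rewrite dot_cross_rot crossC cay oppr0 dotC dot0l. Qed.

Lemma dot_cross0l a x y : cross a x = 0 -> dot a (cross x y) = 0.
Proof. by move=> cax; rewrite crossC dotC dotNl dotC dot_cross0r ?oppr0. Qed.

Lemma cross_neq0l x y : cross x y != 0 -> x != 0.
Proof. by apply: contraNneq => ->; rewrite cross0l. Qed.

(* With n = l1 x l2, (n.n) m is a combination of n, (m.l1) (l2 x n) and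
   (m.l2) (n x l1). *)
Lemma orth2_cross0 l1 l2 x y : cross l1 l2 != 0 ->
  dot x l1 = 0 -> dot x l2 = 0 -> dot y l1 = 0 -> dot y l2 = 0 ->
  cross x y = 0.
Proof.
set n := cross l1 l2 => n0 x1 x2 y1 y2.
have orthE z : dot z l1 = 0 -> dot z l2 = 0 -> cross z n = 0.
  by move=> z1 z2; rewrite cross_crossr z1 z2 !scale0r subr0.
rewrite (cross0_scale n0 (orthE x x1 x2)) (cross0_scale n0 (orthE y y1 y2)).
by rewrite crossZl crossC crossZl cross_self !(scaler0, oppr0).
Qed.

Lemma exists_orth2 l1 l2 : exists x, [/\ x != 0, dot x l1 = 0 & dot x l2 = 0].
Proof.
have [cl|cl] := eqVneq (cross l1 l2) 0; last first.
  by exists (cross l1 l2); rewrite cl dotC dot_crossl dotC dot_crossr.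
(* For parallel vectors, orthogonality to a nonzero one of them implies orthogonality to the
   other. *)
have exo l : exists2 x, x != 0 & dot x l = 0.
  have [l00|l00] := eqVneq (l 0 0) 0.
    exists (delta_mx 0 0); last by rewrite /dot !mxE /= l00; ring.
    by apply/eqP=> /rowP /(_ 0); rewrite !mxE eqxx /=; apply/eqP; rewrite oner_eq0.
  exists (cross l (delta_mx 0 1)); last by rewrite dotC dot_crossl.
  apply: contraNneq l00 => /rowP /(_ 2); rewrite !mxE /=.
  by move=> h; apply/eqP; rewrite -[RHS]h; ring.
have [l10|l10] := eqVneq l1 0.
  by have [x x0 xl] := exo l2; exists x; rewrite l10 [dot x 0]dotC dot0l.
have [x x0 xl] := exo l1; exists x; split=> //.
rewrite (@cross0_scale l2 l1) //; first by rewrite dotC dotZl [dot l1 x]dotC xl mulr0.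
by rewrite crossC cl oppr0.
Qed.

Lemma exists_orth_dot l n : cross l n != 0 -> exists2 x, dot x l = 0 & dot x n != 0.
Proof.
(* The witness is [dot l l *: n - dot n l *: l], up to scale the part of [n] orthogonal to [l]; it
   pairs with [n] to the squared norm of [cross l n]. *)
move=> cln; exists (cross (cross l n) l).
  by rewrite dotC dot_crossr.
have -> : dot (cross (cross l n) l) n = dot (cross l n) (cross l n).
  by rewrite /dot !mxE /=; ring.
by rewrite dot_eq0.
Qed.

End CrossProduct.

Lemma pairingE (R : realType) (a c : 'rV[R]_3) : pairing a c = dot a (hodge c).
Proof.
rewrite /pairing !big_ord_recl big_ord0 addr0 addrA /dot.
have -> : lift ord0 ord0 = 1 :> 'I_3 by apply/val_inj.
by have -> : lift ord0 (lift ord0 ord0) = 2 :> 'I_3 by apply/val_inj.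
Qed.

Lemma hodge_wedge (R : realType) (x y : 'rV[R]_3) : hodge (wedge x y) = cross x y.
Proof. by apply: row3P; rewrite !mxE /=; ring. Qed.

(** * Conditions that are open along lines *)

Section Genericity.
Variables (R : realFieldType) (U : lmodType R).
Implicit Types (p q : U) (P Q W : U -> Prop) (phi psi : U -> R).

(** Polynomiality is asked only along affine lines, where univariate polynomials suffice. *)
Definition regular phi := forall p q,
  exists f : {poly R}, forall t, phi (p + t *: (q - p)) = f.[t].

(** Zariski openness tested on each line through a point of [P]: the exceptional parameters are
    roots of one polynomial, and 0, the parameter of [p], is not a root. *)
Definition line_open P := forall p q, P p ->
  exists2 f : {poly R}, f.[0] != 0 & forall t, f.[t] != 0 -> P (p + t *: (q - p)).

Definition line_closed W := forall p q t, W p -> W q -> W (p + t *: (q - p)).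

Lemma regular_const k : regular (fun=> k).
Proof. by move=> p q; exists k%:P => t; rewrite hornerC. Qed.

Lemma regularD phi psi :
  regular phi -> regular psi -> regular (fun p => phi p + psi p).
Proof.
move=> rphi rpsi p q; have [[f fE] [g gE]] := (rphi p q, rpsi p q).
by exists (f + g) => t; rewrite hornerD fE gE.
Qed.

Lemma regularM phi psi :
  regular phi -> regular psi -> regular (fun p => phi p * psi p).
Proof.
move=> rphi rpsi p q; have [[f fE] [g gE]] := (rphi p q, rpsi p q).
by exists (f * g) => t; rewrite hornerM fE gE.
Qed.

Lemma regularB phi psi :
  regular phi -> regular psi -> regular (fun p => phi p - psi p).
Proof.
move=> rphi rpsi p q; have [[f fE] [g gE]] := (rphi p q, rpsi p q).
by exists (f - g) => t; rewrite hornerD hornerN fE gE.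
Qed.

Lemma line_open_neq0 phi : regular phi -> line_open (fun p => phi p != 0).
Proof.
move=> rphi p q phip; have [f fE] := rphi p q.
exists f => [|t]; rewrite -fE //.
by rewrite scale0r addr0.
Qed.

Lemma line_openI P Q :
  line_open P -> line_open Q -> line_open (fun p => P p /\ Q p).
Proof.
move=> oP oQ p q [Pp Qp].
have [[f f0 fP] [g g0 gQ]] := (oP p q Pp, oQ p q Qp).
exists (f * g) => [|t]; rewrite hornerM; first exact: mulf_neq0.
by rewrite mulf_eq0 negb_or => /andP[/fP ? /gQ ?].
Qed.

Lemma line_open_forall (T : finType) (P : T -> U -> Prop) :
  (forall i, line_open (P i)) -> line_open (fun p => forall i, P i p).
Proof.
move=> oP p q Pp.
have [f f0 fP] : exists2 f : T -> {poly R}, forall i, (f i).[0] != 0 &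
    forall i t, (f i).[t] != 0 -> P i (p + t *: (q - p)).
  apply: (fin_all_exists2 (P := fun i (f : {poly R}) => f.[0] != 0)
    (Q := fun i f => forall t, f.[t] != 0 -> P i (p + t *: (q - p)))) => i.
  exact: oP.
exists (\prod_i f i) => [|t]; rewrite horner_prod.
  by apply/prodf_neq0 => i _; exact: f0.
by move/prodf_neq0 => ft i; apply: fP; exact: ft.
Qed.

(** In characteristic 0 the first [size f] natural numbers are distinct, too many to be all
    roots. *)
Lemma poly_exists_neq0 (f : {poly R}) : f != 0 -> exists t, f.[t] != 0.
Proof.
move=> f0; have := @max_poly_roots _ f [seq i%:R | i <- iota 0 (size f)] f0.
rewrite size_map size_iota ltnn.
case: allP => [_ H|+ _].
  by have := H isT; rewrite map_inj_uniq ?iota_uniq // => [/(_ isT)|? ? /eqP];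
    rewrite ?eqr_nat // => /eqP.
move=> nroot; have /allPn[t _] : ~~ all (root f) [seq i%:R | i <- iota 0 (size f)].
  by apply/negP => /allP.
by exists t.
Qed.

(** The line joining the two witnesses stays in [W]; on it [P] and [Q] each fail at finitely many
    parameters only. *)
Lemma line_open_meet W P Q : line_closed W -> line_open P -> line_open Q ->
  (exists2 p, W p & P p) -> (exists2 p, W p & Q p) ->
  exists2 p, W p & P p /\ Q p.
Proof.
move=> cW oP oQ [p Wp Pp] [q Wq Qq].
have [[f f0 fP] [g g0 gQ]] := (oP p q Pp, oQ q p Qq).
(* [g] is parametrized from [q] towards [p], so it is read backwards. *)
pose h := f * (g \Po (1 - 'X)).
have [t] : exists t, h.[t] != 0.
  apply: poly_exists_neq0; apply: mulf_neq0.
    by apply: contraNneq f0 => ->; rewrite horner0.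
  apply: contraNneq g0 => /(congr1 (horner^~ 1)).
  by rewrite horner_comp !hornerE subrr => ->.
rewrite hornerM horner_comp !hornerE mulf_eq0 negb_or => /andP[/fP Pt /gQ Qt].
exists (p + t *: (q - p)); first exact: cW.
split=> //; congr (Q _): Qt.
by rewrite scalerBl scale1r addrA subrKC -scalerN opprB.
Qed.

Lemma line_open_all (T : finType) W (P : T -> U -> Prop) :
  line_closed W -> (forall i, line_open (P i)) -> (exists p, W p) ->
  (forall i, exists2 p, W p & P i p) -> exists2 p, W p & forall i, P i p.
Proof.
move=> cW oP [p0 Wp0] exP.
suff [p Wp Pp] : exists2 p, W p & forall i, i \in enum T -> P i p.
  by exists p => // i; apply: Pp; rewrite mem_enum.
elim: (enum T) => [|i s [q Wq Pq]]; first by exists p0.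
have oPs : line_open (fun p => forall j, j \in s -> P j p).
  have oPj (j : seq_sub s) : line_open (P (ssval j)) by [].
  move=> p r Pp; have [|f f0 fP] := line_open_forall oPj (p := p) r.
    by move=> j; apply: Pp; exact: ssvalP.
  by exists f => // t /fP Pt j js; exact: (Pt (SeqSub js)).
have [p Wp [Pi Ps]] := line_open_meet cW (oP i) oPs (exP i) (ex_intro2 _ _ q Wq Pq).
by exists p => // j; rewrite inE => /predU1P[->|/Ps].
Qed.

(* If the system has full column rank at [p], it has a left inverse there, and
   the determinant of its product with the system is polynomial along lines. *)
Lemma line_open_inj (C K : finType) (a : C -> K -> U -> R) :
  (forall c k, regular (a c k)) ->
  line_open (fun p => forall x : K -> R,
    (forall c, \sum_k a c k p * x k = 0) -> forall k, x k = 0).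
Proof.
move=> ra p q inj_p.
have [F FE] : exists F : C * K -> {poly R},
    forall ck t, a ck.1 ck.2 (p + t *: (q - p)) = (F ck).[t].
  by apply: (fin_all_exists (P := fun ck f => forall t, a ck.1 ck.2 (p + t *: (q - p))
    = f.[t])) => ck; exact: ra.
pose A : 'M[{poly R}]_(#|K|, #|C|) :=
  \matrix_(i, j) F (enum_val j, enum_val i).
pose At t := map_mx (horner_eval t) A.
have mulAt t (x : 'rV_#|K|) c : (x *m At t) 0 (enum_rank c) =
    \sum_k a c k (p + t *: (q - p)) * x 0 (enum_rank k).
  rewrite mxE (reindex _ (onW_bij _ (@enum_rank_bij K))) /=.
  apply: eq_bigr => k _; rewrite !mxE !enum_rankK mulrC.
  by rewrite /horner_eval -FE.
have /row_freeP[B AB] : row_free (At 0).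
  rewrite -kermx_eq0; apply/eqP/row_matrixP => i; rewrite row0.
  set x := row i _; apply/rowP => k; rewrite [RHS]mxE -[k]enum_valK.
  apply: (inj_p (fun k => x 0 (enum_rank k))) => c.
  have := mulAt 0 x c; rewrite scale0r addr0 => <-.
  by rewrite -row_mul mulmx_ker row0 mxE.
pose f := \det (A *m map_mx polyC B).
have fE t : f.[t] = \det (At t *m B).
  rewrite -[LHS]/(horner_eval t f) -det_map_mx map_mxM; congr (\det (_ *m _)).
  by apply/matrixP => i j; rewrite !mxE /= /horner_eval hornerC.
exists f => [|t]; rewrite fE; first by rewrite AB det1 oner_neq0.
rewrite -unitfE -[_ \is a _]/(_ \in unitmx) => uAB x Ax k.
pose y : 'rV[R]_#|K| := \row_i x (enum_val i).
suff y0 : y = 0 by have /rowP/(_ (enum_rank k)) := y0; rewrite !mxE enum_rankK.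
rewrite -[y](mulmxK uAB) mulmxA [y *m _](_ : _ = 0) ?mul0mx //.
apply/rowP => j; rewrite -[j]enum_valK mulAt mxE -[RHS](Ax (enum_val j)).
by apply: eq_bigr => l _; rewrite mxE enum_rankK.
Qed.

End Genericity.

(** * Sparse graphs with weighted vertices *)

Section Sparsity.
Local Open Scope nat_scope.
Variable V : finType.
Implicit Types (e : rel V) (w : V -> nat) (X Y A B C : {set V}).

(* Ordered pairs are counted, so each edge of the simple graph [e] inside [Y]
   contributes 2. *)
Definition arcs e Y := \sum_x \sum_y ([&& x \in Y, y \in Y & e x y] : nat).

Definition nbrs e Y v := [set u in Y | e v u].

Definition weight w Y := \sum_(v in Y) w v.

(** Twice the counts obtained from (2) when the dimension is bounded by the number of boundary bars
    (first) or by 3 (second); the equality is twice (3). *)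
Definition sparse e w X :=
  [/\ forall Y, Y \subset X -> 1 < #|Y| -> arcs e Y + 6 <= 4 * #|Y|,
      forall Y, Y \subset X -> arcs e Y + 2 * weight w Y <= 4 * #|Y|
    & arcs e X + 2 * weight w X = 4 * #|X|].

Definition add_edge e a b : rel V :=
  fun x y => [|| e x y, (x == a) && (y == b) | (x == b) && (y == a)].

Lemma add_edge_sym e a b : symmetric e -> symmetric (add_edge e a b).
Proof. by move=> se x y; rewrite /add_edge se [X in _ || X]orbC ![(y == _) && _]andbC.
  Qed.

Lemma add_edge_irr e a b : irreflexive e -> a != b -> irreflexive (add_edge e a b).
Proof.
move=> ie ab x; rewrite /add_edge ie /= orbC andbC orbb.
by apply/negbTE; apply: contra ab => /andP[/eqP <-].
Qed.

Lemma weight_subset w A B : A \subset B -> weight w A <= weight w B.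
Proof.
move=> sAB; rewrite /weight [leqRHS](big_setID A) /=.
by rewrite (setIidPr sAB) leq_addr.
Qed.

(** Checked arc by arc; arcs joining the two differences only help the right-hand side. *)
Lemma arcs_supermodular e A B :
  arcs e A + arcs e B <= arcs e (A :|: B) + arcs e (A :&: B).
Proof.
rewrite -!big_split /=; apply: leq_sum => x _; rewrite -!big_split /=.
apply: leq_sum => y _; rewrite !inE.
by do 5 case: (_ \in _) || case: (e x y).
Qed.

Lemma weight_modular w A B :
  weight w A + weight w B = weight w (A :|: B) + weight w (A :&: B).
Proof.
rewrite /weight ![\sum_(v in _) _]big_mkcond /= -!big_split /=.
by apply: eq_bigr => v _; rewrite !inE; case: (v \in A); case: (v \in B);
  rewrite /= ?addn0.
Qed.

Lemma eq_sparse e w w' X : w =1 w' -> sparse e w X -> sparse e w' X.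
Proof.
move=> ww'; have wE Y : weight w' Y = weight w Y by apply: eq_bigr => v _.
by case=> spL spP spE; split=> // [Y|]; rewrite wE //; exact: spP.
Qed.

Lemma arcs0 e : arcs e set0 = 0.
Proof. by apply: big1 => x _; apply: big1 => y _; rewrite inE. Qed.

Lemma sum_eq_l (v : V) (F : V -> nat) : \sum_x (x == v) * F x = F v.
Proof.
by rewrite (bigD1 v) //= eqxx mul1n big1 ?addn0 // => x /negbTE->.
Qed.

Lemma arcs_setU1 e Y v : symmetric e -> irreflexive e -> v \notin Y ->
  arcs e (v |: Y) = arcs e Y + 2 * #|nbrs e Y v|.
Proof.
move=> se ie vY.
have -> : arcs e (v |: Y) = \sum_x \sum_y
    ([&& x \in Y, y \in Y & e x y] + ((x == v) * ((y \in Y) && e v y)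
     + (y == v) * ((x \in Y) && e v x))).
  apply: eq_bigr => x _; apply: eq_bigr => y _; rewrite !inE.
  have [->|xv] := eqVneq x v; have [->|yv] := eqVneq y v;
    rewrite ?ie ?(negbTE vY) /= ?mul0n ?mul1n ?addn0 ?[e x v]se //.
  by case: (_ \in _).
under eq_bigr => x _ do rewrite big_split big_split /= sum_eq_l -big_distrr /=.
rewrite big_split /= big_split /= sum_eq_l; congr (_ + _).
have cardE : \sum_x ((x \in Y) && e v x : nat) = #|nbrs e Y v|.
  rewrite -sum1_card [RHS]big_mkcond /=.
  by apply: eq_bigr => x _; rewrite inE; case: (_ && _).
by rewrite cardE mul2n addnn.
Qed.

Lemma weight_setU1 w Y v : v \notin Y -> weight w (v |: Y) = w v + weight w Y.
Proof. exact: big_setU1. Qed.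

(** Parity turns a strict count into a slack of 2, exactly what one new edge or one new line
    consumes. *)
Lemma arcs_even e Y : symmetric e -> irreflexive e -> ~~ odd (arcs e Y).
Proof.
move=> se ie; have [n] := ubnP #|Y|; elim: n Y => // n IHn Y ltYn.
have [->|[v vY]] := set_0Vmem Y; first by rewrite arcs0.
rewrite -(setD1K vY) arcs_setU1 ?inE ?eqxx // oddD mul2n odd_double addbF.
by apply: IHn; rewrite (cardsD1 v) vY in ltYn.
Qed.

Lemma arcs_set1 e v : irreflexive e -> arcs e [set v] = 0.
Proof.
move=> ie; apply: big1 => x _; apply: big1 => y _; rewrite !inE.
by case: eqP => // ->; case: eqP => // ->; rewrite ie.
Qed.

Lemma arcs_add_edge e Y a b : a != b -> ~~ e a b -> symmetric e ->
  arcs (add_edge e a b) Y = arcs e Y + 2 * ((a \in Y) && (b \in Y)).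
Proof.
move=> ab nab se; have ba : b != a by rewrite eq_sym.
have -> : arcs (add_edge e a b) Y = \sum_x \sum_y
    ([&& x \in Y, y \in Y & e x y]
     + ((x == a) * ((y == b) * ((a \in Y) && (b \in Y)))
     + (x == b) * ((y == a) * ((a \in Y) && (b \in Y))))).
  apply: eq_bigr => x _; apply: eq_bigr => y _; rewrite /add_edge.
  have [->|xa] := eqVneq x a; have [->|yb] := eqVneq y b;
    rewrite ?(negbTE ab) ?(negbTE ba) ?(negbTE nab) /=
      ?mul0n ?muln0 ?mul1n ?addn0 ?andbF ?orbF ?andbT //.
  have [->|xb] := eqVneq x b; have [->|ya] := eqVneq y a;
    rewrite /= ?mul0n ?mul1n ?addn0 ?orbF //.
  by rewrite se (negbTE nab) /=; case: (_ \in _); case: (_ \in _).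
under eq_bigr => x _ do
  rewrite big_split big_split /= -!big_distrr /= !sum_eq_l.
by rewrite big_split /= big_split /= !sum_eq_l mul2n addnn.
Qed.

Lemma sum_nbrs e X :
  \sum_(v in X) #|nbrs e X v| = arcs e X.
Proof.
rewrite /arcs [LHS]big_mkcond /=; apply: eq_bigr => v _.
case: ifP => vX /=; last by rewrite big1.
rewrite -sum1_card [LHS]big_mkcond /=.
by apply: eq_bigr => u _; rewrite inE; case: (_ && _).
Qed.

(** * Removing a vertex of small degree from a sparse graph *)

Section Vertex.
Variables (e : rel V) (w : V -> nat) (X : {set V}).
Hypotheses (se : symmetric e) (ie : irreflexive e) (spX : sparse e w X).

(** Edges alone do not reach [4 * #|X|]: by the first count if [X] has at least two vertices, and
    for lack of arcs if it has one. *)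
Lemma sparse_weight_gt0 : X != set0 -> 0 < weight w X.
Proof.
have [spL _ spE] := spX; move=> X0.
have [X1|X1] := ltnP 1 #|X|; first by have := spL X (subxx _) X1; lia.
have /cards1P[v Xv] : #|X| == 1 by rewrite eqn_leq X1 card_gt0.
by move: spE; rewrite Xv arcs_set1 // cards1; lia.
Qed.

Lemma sparse_weight v : v \in X -> w v <= 2.
Proof.
have [_ spP _] := spX; move=> vX.
by have := spP [set v]; rewrite sub1set cards1 arcs_set1 // /weight big_set1 => /(_
  vX); lia.
Qed.

Lemma arcsD1 v : v \in X -> arcs e X = arcs e (X :\ v) + 2 * #|nbrs e (X :\ v) v|.
Proof. by move=> vX; rewrite -arcs_setU1 ?setD1K // !inE eqxx. Qed.

Lemma nbrsD1 v : nbrs e (X :\ v) v = nbrs e X v.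
Proof. by apply/setP=> u; rewrite !inE; case: eqP => // ->; rewrite ie !andbF. Qed.

Lemma weightD1 v : v \in X -> weight w X = w v + weight w (X :\ v).
Proof. by move=> vX; rewrite -weight_setU1 ?setD1K // !inE eqxx. Qed.

(** Compare the equality on [X] with the count on [X :\ v], whose right-hand side is smaller by
    4. *)
Lemma sparse_deg v : v \in X -> 2 <= #|nbrs e X v| + w v.
Proof.
have [_ spP spE] := spX; move=> vX; have := spP (X :\ v) (subsetDl _ _).
have := cardsD1 v X; rewrite vX /= -(nbrsD1 v).
by have := arcsD1 vX; have := weightD1 vX; lia.
Qed.

(* The numbers deg v + 2 w v have average 4 on X and w does not vanish, so some
   vertex is below average or is average with w v > 0. *)
Lemma sparse_vertex : X != set0 -> exists2 v, v \in X &
  (#|nbrs e X v|, w v) \in [:: (0, 2); (1, 1); (2, 0); (2, 1); (3, 0)].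
Proof.
move=> X0; have [_ _ spE] := spX.
have [/existsP[v /andP[vX small]]|/existsPn large] :=
  boolP [exists v, (v \in X) && (#|nbrs e X v| + 2 * w v < 4 + (0 < w v))].
  exists v => //; have := sparse_deg vX; have := sparse_weight vX.
  move: small; case: #|_| => [|[|[|[|k]]]]; case: (w v) => [|[|[|j]]] //=; lia.
have : \sum_(v in X) (4 + (0 < w v)) <= \sum_(v in X) (#|nbrs e X v| + 2 * w v).
  by apply: leq_sum => v vX; have := large v; rewrite vX -leqNgt.
rewrite big_split [leqRHS]big_split /= sum_nbrs.
have -> : \sum_(v in X) 2 * w v = 2 * weight w X by rewrite /weight big_distrr.
rewrite spE sum_nat_const.
rewrite mulnC -[leqRHS]addn0 leq_add2l leqn0 sum_nat_eq0 => /forall_inP w0.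
have := sparse_weight_gt0 X0; rewrite lt0n sum_nat_eq0 negb_forall_in.
by case/exists_inP=> v /w0; case: (w v).
Qed.

(** Both sides of the equality drop by 4, and the counts on subsets are inherited. *)
Lemma sparse_delete v : v \in X -> #|nbrs e X v| + w v = 2 ->
  sparse e w (X :\ v).
Proof.
move=> vX dv; have [spL spP spE] := spX.
have sX Y : Y \subset X :\ v -> Y \subset X by move/subset_trans; apply;
  exact: subsetDl.
split=> [Y /sX/spL|Y /sX/spP|] //.
have := cardsD1 v X; rewrite vX /=; move: dv; rewrite -(nbrsD1 v).
by have := arcsD1 vX; have := weightD1 vX; lia.
Qed.

(** These are the counts of [v |: Y]: a set that contains all neighbours of [v] must leave room for
    the contribution of [v]. *)
Lemma sparse_setU1 v Y : v \in X -> Y \subset X :\ v ->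
  nbrs e X v \subset Y -> Y != set0 ->
  arcs e Y + 2 * #|nbrs e X v| + 2 <= 4 * #|Y| /\
  arcs e Y + 2 * weight w Y + 2 * #|nbrs e X v| + 2 * w v <= 4 * #|Y| + 4.
Proof.
move=> vX sY sN Y0; have [spL spP _] := spX.
have vY : v \notin Y by apply/negP => /(subsetP sY); rewrite !inE eqxx.
have svY : v |: Y \subset X.
  by rewrite subUset sub1set vX (subset_trans sY) // subsetDl.
have nE : nbrs e Y v = nbrs e X v.
  apply/setP=> u; apply/idP/idP => [|uN].
    by rewrite !inE => /andP[/(subsetP sY)]; rewrite !inE => /andP[_ ->].
  by have := subsetP sN u uN; rewrite !inE => -> /=; move: uN; rewrite inE => /andP[].
have := spL _ svY; have := spP _ svY.
rewrite arcs_setU1 // nE weight_setU1 // cardsU1 vY /=.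
by move: Y0; rewrite -card_gt0; lia.
Qed.

(** One of the two counts is attained, so an edge added inside [Y] would violate it. *)
Definition tight Y :=
  (1 < #|Y|) && (arcs e Y + 6 == 4 * #|Y|) || (arcs e Y + 2 * weight w Y == 4 * #|Y|).

Lemma sparse_add_edge v a b : v \in X -> #|nbrs e X v| = 3 -> w v = 0 ->
  a \in nbrs e X v -> b \in nbrs e X v -> a != b ->
  (forall Y, Y \subset X :\ v -> a \in Y -> b \in Y -> ~~ tight Y) ->
  ~~ e a b /\ sparse (add_edge e a b) w (X :\ v).
Proof.
move=> vX d3 w0 aN bN ab nt; have [spL spP spE] := spX.
have inXv u : u \in nbrs e X v -> u \in X :\ v by rewrite -nbrsD1 // inE => /andP[].
have sX Y : Y \subset X :\ v -> Y \subset X by move/subset_trans; apply;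
  exact: subsetDl.
have ev Y := arcs_even Y se ie.
(* If [a] and [b] were adjacent, [[set a; b]] would be tight: its two arcs give 2 + 6 = 4 * 2. *)
have nab : ~~ e a b.
  have sab : [set a; b] \subset X :\ v by rewrite subUset !sub1set !inXv.
  have := nt _ sab; rewrite !inE !eqxx orbT => /(_ isT isT).
  have aNb : a \notin [set b] by rewrite inE.
  rewrite /tight cards2 ab arcs_setU1 // arcs_set1 //=; apply: contraNN => eab.
  by rewrite (_ : nbrs _ _ _ = [set b]) ?cards1 //; apply/setP=> u;
    rewrite !inE andb_idr // => /eqP->.
split=> //; split=> [Y sY Y1|Y sY|]; rewrite arcs_add_edge //.
- have := spL Y (sX Y sY) Y1.
  have [/andP[aY bY]|_] := boolP ((a \in Y) && (b \in Y)); last by lia.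
  have := nt Y sY aY bY; rewrite /tight Y1 /=.
  by have := ev Y; lia.
- have := spP Y (sX Y sY).
  have [/andP[aY bY]|_] := boolP ((a \in Y) && (b \in Y)); last by lia.
  have := nt Y sY aY bY; rewrite /tight negb_or => /andP[_].
  by have := ev Y; lia.
have := cardsD1 v X; rewrite !inXv // vX /=.
have := arcsD1 vX; have := weightD1 vX; rewrite nbrsD1; lia.
Qed.

(** Add the two tight counts by supermodularity. The union falls short by the contribution of [v],
    so the intersection cannot also satisfy its own count: the first count holds on two or more
    vertices, and the weighted one on any set, which excludes that both sets are tight only for the
    weighted count. *)
Lemma sparse_tightU v A B : v \in X ->
  #|nbrs e X v| = 3 -> w v = 0 -> A \subset X :\ v -> B \subset X :\ v ->
  nbrs e X v \subset A :|: B -> A != set0 ->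
  tight A -> tight B -> #|A :&: B| <= 1 /\
  (arcs e A + 6 = 4 * #|A| \/ arcs e B + 6 = 4 * #|B|).
Proof.
move=> vX d3 w0 sA sB sN A0 tA tB; have [spL spP _] := spX.
have sX Y : Y \subset X :\ v -> Y \subset X by move/subset_trans; apply;
  exact: subsetDl.
have sI : A :&: B \subset X by apply: subset_trans (sX _ sA); exact: subsetIl.
have sU : A :|: B \subset X :\ v by rewrite subUset sA.
have U0 : A :|: B != set0.
  by apply: contraNneq A0 => U0; rewrite -subset0 -U0 subsetUl.
have [uL uP] := sparse_setU1 vX sU sN U0.
have := arcs_supermodular e A B; have := weight_modular w A B.
have := cardsUI A B; have := spP _ sI; have := spL _ sI.
have := weight_subset w (subsetUl A B); have := weight_subset w (subsetUr A B).
have := weight_subset w (subsetIl A B); have := weight_subset w (subsetIr A B).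
move: tA tB; rewrite /tight; lia.
Qed.

(** Were all three pairs of neighbours blocked by tight sets [A], [B], [C], these would pairwise
    share a single vertex, at least two of them being tight for the first count. Adding their counts
    then contradicts the sharpened counts of the union, which contains all neighbours of [v]. *)
Lemma sparse_split_edge v : v \in X -> #|nbrs e X v| = 3 -> w v = 0 ->
  exists a b c, [/\ nbrs e X v = [set a; b; c], uniq [:: a; b; c], ~~ e a b
                  & sparse (add_edge e a b) w (X :\ v)].
Proof.
move=> vX d3 w0.
have [a [b [c [Nabc uabc]]]] : exists a b c,
    nbrs e X v = [set a; b; c] /\ uniq [:: a; b; c].
  have := d3; rewrite cardE; case Es: (enum _) => [|a [|b [|c []]]] // _.
  exists a, b, c; split; last by rewrite -Es enum_uniq.
  by apply/setP=> u; rewrite -mem_enum Es !inE orbA.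
have Nbca : nbrs e X v = [set b; c; a] by rewrite Nabc [in RHS]setUC setUA.
have Ncab : nbrs e X v = [set c; a; b] by rewrite Nbca [in RHS]setUC setUA.
have ubca : uniq [:: b; c; a] by rewrite -(rot_uniq 1) in uabc.
have ucab : uniq [:: c; a; b] by rewrite -(rot_uniq 1) in ubca.
pose blocked x y := [exists Y : {set V}, [&& Y \subset X :\ v, x \in Y, y \in Y & tight
  Y]].
have free x y z : nbrs e X v = [set x; y; z] -> uniq [:: x; y; z] -> ~~ blocked x y ->
    exists a b c, [/\ nbrs e X v = [set a; b; c], uniq [:: a; b; c], ~~ e a b
                  & sparse (add_edge e a b) w (X :\ v)].
  move=> Nxyz uxyz nb; exists x, y, z.
  have [||||nxy sp] := @sparse_add_edge v x y vX d3 w0;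
    rewrite ?Nxyz ?inE ?eqxx ?orbT //.
    by move: uxyz => /= /andP[]; rewrite !inE negb_or => /andP[].
  move=> Y sY xY yY; move: nb => /existsPn/(_ Y); rewrite sY xY yY //.
have [bab|] := boolP (blocked a b); last exact: free Nabc uabc.
have [bbc|] := boolP (blocked b c); last exact: free Nbca ubca.
have [bca|] := boolP (blocked c a); last exact: free Ncab ucab.
move: bab bbc bca => /existsP[A /and4P[sA aA bA tA]] /existsP[B /and4P[sB bB cB tB]]
  /existsP[C /and4P[sC cC aC tC]].
exfalso.
have subN Y x y z : nbrs e X v = [set x; y;
  z] -> x \in Y -> y \in Y -> z \in Y -> nbrs e X v \subset Y.
  by move=> -> xY yY zY; rewrite !subUset !sub1set xY yY zY.
have ne (x : V) Y : x \in Y -> Y != set0 by move=> xY; apply/set0Pn; exists x.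
have [AB1 ABL] : #|A :&: B| <= 1 /\ (arcs e A + 6 = 4 * #|A| \/ arcs e B + 6 = 4 *
  #|B|).
  by apply: (@sparse_tightU v) (ne _ _ aA) tA tB => //; apply: (subN _ _ _ _ Nabc);
    rewrite inE ?aA ?bA ?cB ?orbT.
have [BC1 BCL] : #|B :&: C| <= 1 /\ (arcs e B + 6 = 4 * #|B| \/ arcs e C + 6 = 4 *
  #|C|).
  by apply: (@sparse_tightU v) (ne _ _ bB) tB tC => //; apply: (subN _ _ _ _ Nbca);
    rewrite inE ?bB ?cB ?aC ?orbT.
have [CA1 CAL] : #|C :&: A| <= 1 /\ (arcs e C + 6 = 4 * #|C| \/ arcs e A + 6 = 4 *
  #|A|).
  by apply: (@sparse_tightU v) (ne _ _ cC) tC tA => //; apply: (subN _ _ _ _ Ncab);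
    rewrite inE ?cC ?aC ?bA ?orbT.
pose U := A :|: B :|: C.
have sU : U \subset X :\ v by rewrite !subUset sA sB.
have aU : a \in U by rewrite !inE aA.
have [uL uP] : arcs e U + 2 * #|nbrs e X v| + 2 <= 4 * #|U| /\
    arcs e U + 2 * weight w U + 2 * #|nbrs e X v| + 2 * w v <= 4 * #|U| + 4.
  by apply: sparse_setU1 (ne _ _ aU) => //; apply: (subN _ _ _ _ Nabc);
    rewrite !inE ?aA ?bA ?cB ?orbT.
(* Two of the sets share at most one vertex, so no arc is counted twice. *)
have arcsU : arcs e A + arcs e B + arcs e C <= arcs e U.
  have common (P Q : {set V}) x y : #|P :&: Q| <= 1 -> x != y ->
      [&& x \in P, y \in P, x \in Q & y \in Q] = false.
    move=> PQ1 xy; apply/negP => /and4P[xP yP xQ yQ].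
    have : [set x; y] \subset P :&: Q by rewrite subUset !sub1set !inE xP yP xQ yQ.
    by move/subset_leq_card; rewrite cards2 xy => /leq_trans/(_ PQ1).
  rewrite -!big_split /=; apply: leq_sum => x _; rewrite -!big_split /=.
  apply: leq_sum => y _; rewrite !inE.
  have [->|xy] := eqVneq x y; first by rewrite ie !andbF.
  have := common _ _ _ _ AB1 xy; have := common _ _ _ _ BC1 xy;
    have := common _ _ _ _ CA1 xy.
  by case: (x \in A); case: (x \in B); case: (x \in C); case: (y \in A);
    case: (y \in B); case: (y \in C); case: (e x y).
(* [b] is counted twice in [A] and [B], and [c] and [a] are counted again in [C]. *)
have cardU : #|U| + 3 <= #|A| + #|B| + #|C|.
  have ca : c != a by move: ucab => /= /andP[]; rewrite !inE negb_or => /andP[].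
  have : [set b] \subset A :&: B by rewrite sub1set inE bA.
  have : [set c; a] \subset (A :|: B) :&: C by rewrite subUset !sub1set !inE aA cB aC
    cC orbT.
  move=> /subset_leq_card + /subset_leq_card; rewrite cards2 cards1 ca.
  by have := cardsUI A B; have := cardsUI (A :|: B) C; rewrite /U; clear; lia.
have wU (Y : {set V}) : Y \subset U -> weight w Y <= weight w U by exact: weight_subset.
have wA : weight w A <= weight w U by apply: wU; rewrite /U -setUA subsetUl.
have wB : weight w B <= weight w U by apply: wU; rewrite /U setUAC subsetUr.
have wC : weight w C <= weight w U by apply: wU; rewrite /U subsetUr.
have tightE Y : tight Y -> arcs e Y + 6 = 4 * #|Y| \/ arcs e Y + 2 * weight w Y = 4 *
  #|Y|.
  by case/orP => [/andP[_ /eqP]|/eqP]; [left|right].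
move/tightE: tA => tA; move/tightE: tB => tB; move/tightE: tC => tC.
move: uL uP arcsU cardU wA wB wC tA tB tC ABL BCL CAL; rewrite d3 w0; clear.
move: (arcs e U) (arcs e A) (arcs e B) (arcs e C) (weight w U) (weight w A)
  (weight w B) (weight w C) => u1 a1 b1 c1 u2 a2 b2 c2.
move: #|U| #|A| #|B| #|C| => u3 a3 b3 c3 uL uP arcsU cardU wA wB wC tA tB tC.
by case=> L1; case=> L2; case=> L3; try lia;
  (case: tA; case: tB; case: tC); lia.
Qed.

(** If both neighbours lay in sets attaining the weighted count, the union of these sets would
    attain it by supermodularity, leaving no room for [v]. *)
Lemma sparse_move_weight v : v \in X -> #|nbrs e X v| = 2 -> w v = 1 ->
  exists a c, [/\ nbrs e X v = [set a; c], a != c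
                & sparse e (fun u => w u + (u == a)) (X :\ v)].
Proof.
move=> vX d2 w1; have [spL spP spE] := spX.
have /eqP/cards2P[a [c [ac Nac]]] := d2.
have Nca : nbrs e X v = [set c; a] by rewrite Nac setUC.
have ca : c != a by rewrite eq_sym.
have weightE u Y : weight (fun s => w s + (s == u)) Y = weight w Y + (u \in Y).
  rewrite /weight big_split /=; congr (_ + _).
  have [uY|uY] := boolP (u \in Y).
    by rewrite (bigD1 u) //= eqxx big1 // => s /andP[_ /negbTE->].
  by rewrite big1 // => s sY; case: eqP sY uY => // -> ->.
have sX Y : Y \subset X :\ v -> Y \subset X by move/subset_trans; apply;
  exact: subsetDl.
have inXv u : u \in nbrs e X v -> u \in X :\ v by rewrite -nbrsD1 // inE => /andP[].
pose blocked x := [exists Y : {set V}, [&& Y \subset X :\ v, x \in Y &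
  arcs e Y + 2 * weight w Y == 4 * #|Y|]].
have free x y : nbrs e X v = [set x; y] -> x != y -> ~~ blocked x ->
    exists a c, [/\ nbrs e X v = [set a; c], a != c
                & sparse e (fun u => w u + (u == a)) (X :\ v)].
  move=> Nxy xy nb; exists x, y; split=> //; split=> [Y /sX/spL //|Y sY|].
    rewrite weightE; have := spP Y (sX Y sY).
    have [xY|_] := boolP (x \in Y); last by lia.
    move: nb => /existsPn/(_ Y); rewrite sY xY /=.
    by have := arcs_even Y se ie; lia.
  rewrite weightE inXv; last by rewrite Nxy !inE eqxx.
  have := cardsD1 v X; rewrite vX /=.
  by have := arcsD1 vX; have := weightD1 vX; rewrite nbrsD1; lia.
have [ba|] := boolP (blocked a); last exact: free Nac ac.
have [bc|] := boolP (blocked c); last exact: free Nca ca.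
move: ba bc => /existsP[A /and3P[sA aA /eqP tA]] /existsP[C /and3P[sC cC /eqP tC]].
exfalso.
have sU : A :|: C \subset X :\ v by rewrite subUset sA.
have sN : nbrs e X v \subset A :|: C.
  by rewrite Nac subUset !sub1set !inE aA cC orbT.
have U0 : A :|: C != set0 by apply/set0Pn; exists a; rewrite inE aA.
have [_ uP] := sparse_setU1 vX sU sN U0.
have sI : A :&: C \subset X by apply: subset_trans (sX _ sA); exact: subsetIl.
have := arcs_supermodular e A C; have := weight_modular w A C.
by have := cardsUI A C; have := spP _ sI; lia.
Qed.

End Vertex.
End Sparsity.

(** * Infinitesimal motions *)

Section Realization.
Variables (R : realFieldType) (V I : finType) (l : I -> 'rV[R]_3).
Local Notation config := {ffun V -> 'rV[R]_3}.
Implicit Types (p q : config) (m : V -> 'rV[R]_3) (X : {set V}).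
Implicit Types (e : rel V) (g : V -> {set I}) (F G : config -> 'rV[R]_3).

Definition on_lines g X p :=
  forall v, v \in X -> forall r, r \in g v -> dot (p v) (l r) = 0.

Definition motion e g X p m :=
  (forall x y, x \in X -> y \in X -> e x y ->
     dot (m x - m y) (cross (p x) (p y)) = 0) /\
  (forall v, v \in X -> forall r, r \in g v -> dot (m v) (l r) = 0).

(** Being parallel to the nonzero [p v] at each [v] of [X] is being a combination of danglings on
    [X]. *)
Definition rigid e g X p :=
  (forall v, v \in X -> p v != 0) /\
  (forall m, motion e g X p m -> forall v, v \in X -> cross (m v) (p v) = 0).

(** Coincident points are tolerated here; distinctness is added at the end as one more open
    condition. *)
Definition realizable e g X := exists2 p, on_lines g X p & rigid e g X p.

Definition vregular F := forall k, regular (fun p => F p 0 k).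

Lemma vregular_const u : vregular (fun=> u).
Proof. by move=> k; exact: regular_const. Qed.

Lemma vregular_coord v : vregular (fun p => p v).
Proof.
move=> k p q; exists ((p v 0 k)%:P + 'X * (q v 0 k - p v 0 k)%:P) => t.
by rewrite !ffunE !mxE !hornerE.
Qed.

Lemma regular_dot F G : vregular F -> vregular G -> regular (fun p => dot (F p) (G p)).
Proof. by move=> rF rG; do 2?apply: regularD; apply: regularM. Qed.

Lemma vregular_cross F G : vregular F -> vregular G -> vregular (fun p => cross (F p)
  (G p)).
Proof.
move=> rF rG k p q.
have rM i j : regular (fun p => F p 0 i * G p 0 j) by apply: regularM.
case: k => -[|[|[|//]]] ltk.
- have [f fE] := regularB (rM 1 2) (rM 2 1) p q.
  by exists f => t; rewrite -fE !mxE.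
- have [f fE] := regularB (rM 2 0) (rM 0 2) p q.
  by exists f => t; rewrite -fE !mxE.
- have [f fE] := regularB (rM 0 1) (rM 1 0) p q.
  by exists f => t; rewrite -fE !mxE.
Qed.

Lemma vregularZ k F : vregular F -> vregular (fun p => k *: F p).
Proof.
move=> rF i p q; have [f fE] := regularM (regular_const k) (rF i) p q.
by exists f => t; rewrite -fE !mxE.
Qed.

Lemma line_open_dot F G : vregular F -> vregular G ->
  line_open (fun p => dot (F p) (G p) != 0).
Proof. by move=> rF rG; exact/line_open_neq0/regular_dot. Qed.

Lemma line_open_vneq0 F : vregular F -> line_open (fun p => F p != 0).
Proof.
move=> rF p q; rewrite -dot_eq0 => /(line_open_dot rF rF q)[f f0 fP].
by exists f => // t /fP; rewrite dot_eq0.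
Qed.

Lemma line_open_imply (b : bool) (P : config -> Prop) :
  line_open P -> line_open (fun p => b -> P p).
Proof.
case: b => [oP p q /(_ isT) /(oP p q)[f f0 fP]|_ p q _]; first by exists f => // t /fP.
by exists 1; rewrite // hornerC oner_neq0.
Qed.

Lemma line_closed_on_lines g X : line_closed (on_lines g X).
Proof.
move=> p q t Wp Wq v vX r rv; rewrite !ffunE dotDl dotZl dotBl.
by rewrite (Wp v) // (Wq v) // subrr mulr0 addr0.
Qed.

Lemma sum_dot (a : V -> 'rV[R]_3) (x : V * 'I_3 -> R) :
  \sum_k a k.1 0 k.2 * x k = \sum_v dot (a v) (\row_k x (v, k)).
Proof.
rewrite (eq_bigr (fun k => a k.1 0 k.2 * x (k.1, k.2))); last by case.
rewrite -(pair_bigA _ (fun v k => a v 0 k * x (v, k))) /=.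
apply: eq_bigr => v _; rewrite !big_ord_recl big_ord0 addr0 addrA /dot !mxE.
have -> : lift ord0 ord0 = 1 :> 'I_3 by apply/val_inj.
by have -> : lift ord0 (lift ord0 ord0) = 2 :> 'I_3 by apply/val_inj.
Qed.

Lemma sum_dot_single (x : V) (b : bool) u m :
  \sum_v dot ((b && (v == x))%:R *: u) (m v) = b%:R * dot u (m x).
Proof.
rewrite (bigD1 x) //= eqxx andbT dotZl big1 ?addr0 // => v /negbTE->.
by rewrite andbF scale0r dot0l.
Qed.

(* Motions are normalized by being orthogonal to [p] on [X] and 0 outside [X],
   which leaves an injective linear system. *)
Definition normal_rigid e g X p :=
  forall m, motion e g X p m -> (forall v, v \in X -> dot (m v) (p v) = 0) ->
    (forall v, v \notin X -> m v = 0) -> forall v, m v = 0.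

(** The normalized motions solve a linear system whose coefficients are regular in [p], and
    injectivity of such a system is open along lines. *)
Lemma line_open_normal_rigid e g X : line_open (normal_rigid e g X).
Proof.
(* One equation per pair of vertices, per vertex and line, per normalized vertex, and per coordinate
   to vanish outside [X]; a boolean factor switches off those that do not apply. *)
pose C := (V * V + (V * I + (V + V * 'I_3)))%type.
pose a (c : C) (v : V) p : 'rV[R]_3 := match c with
  | inl (x, y) => ([&& x \in X, y \in X & e x y] && (v == x))%:R *: cross (p x) (p y)
      + ([&& x \in X, y \in X & e x y] && (v == y))%:R *: ((-1) *: cross (p x) (p y))
  | inr (inl (x, r)) => ((x \in X) && (r \in g x) && (v == x))%:R *: l r
  | inr (inr (inl x)) => ((x \in X) && (v == x))%:R *: p x
  | inr (inr (inr (x, k))) => ((x \notin X) && (v == x))%:R *: delta_mx 0 k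
  end.
have ra c (k : V * 'I_3) : regular (fun p => a c k.1 p 0 k.2).
  case: c => [[x y]|[[x r]|[x|[x j]]]] /=.
  - have rc := vregular_cross (vregular_coord x) (vregular_coord y).
    move=> p q.
    have [f fE] := regularD (vregularZ ([&& x \in X, y \in X & e x y] && (k.1 == x))%:R
      rc k.2)
      (vregularZ ([&& x \in X, y \in X & e x y] && (k.1 == y))%:R (vregularZ (-1) rc)
        k.2) p q.
    by exists f => t; rewrite -fE mxE.
  - exact/vregularZ/vregular_const.
  - exact/vregularZ/vregular_coord.
  - exact/vregularZ/vregular_const.
have aE p m : (forall c, \sum_v dot (a c v p) (m v) = 0) <->
    [/\ motion e g X p m, forall v, v \in X -> dot (m v) (p v) = 0
      & forall v, v \notin X -> m v = 0].
  split=> [H|[[me ml] mp m0] c].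
    split; first split.
    - move=> x y xX yX exy; have := H (inl (x, y)) => /=.
      under eq_bigr => v _ do rewrite dotDl.
      rewrite big_split /= !sum_dot_single xX yX exy !mul1r dotZl mulN1r.
      by rewrite dotBl [dot (m x) _]dotC [dot (m y) _]dotC.
    - move=> x xX r rx; have := H (inr (inl (x, r))).
      by rewrite /= sum_dot_single xX rx mul1r dotC.
    - move=> x xX; have := H (inr (inr (inl x))).
      by rewrite /= sum_dot_single xX mul1r dotC.
    - move=> x xX; apply: row3P; rewrite mxE.
      + have := H (inr (inr (inr (x, 0)))).
        by rewrite /= sum_dot_single xX mul1r /dot !mxE /= !mul0r mul1r !addr0.
      + have := H (inr (inr (inr (x, 1)))).
        by rewrite /= sum_dot_single xX mul1r /dot !mxE /= !mul0r mul1r addr0 add0r.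
      + have := H (inr (inr (inr (x, 2)))).
        by rewrite /= sum_dot_single xX mul1r /dot !mxE /= !mul0r mul1r !add0r.
  case: c => [[x y]|[[x r]|[x|[x j]]]] /=; rewrite ?sum_dot_single.
  - under eq_bigr => v _ do rewrite dotDl.
    rewrite big_split /= !sum_dot_single.
    have [/and3P[xX yX exy]|_] := boolP [&& _, _ & _]; last by rewrite !mul0r addr0.
    by rewrite !mul1r dotZl mulN1r dotC [dot _ (m y)]dotC -dotBl me.
  - have [/andP[xX rx]|_] := boolP (_ && _); last by rewrite mul0r.
    by rewrite mul1r dotC ml.
  - have [xX|_] := boolP (_ \in _); last by rewrite mul0r.
    by rewrite mul1r dotC mp.
  - have [xX|xX] /= := boolP (_ \in _); first by rewrite mul0r.
    by rewrite m0 // dotC dot0l mulr0.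
have nrE p : normal_rigid e g X p <-> forall x : V * 'I_3 -> R,
    (forall c, \sum_k a c k.1 p 0 k.2 * x k = 0) -> forall k, x k = 0.
  split=> [nr x Hx [v k]|inj m mm mp m0 v].
    pose m v := \row_k x (v, k).
    have /aE[mm mp m0] : forall c, \sum_v dot (a c v p) (m v) = 0.
      by move=> c; rewrite -sum_dot.
    by have /rowP/(_ k) := nr m mm mp m0 v; rewrite !mxE.
  apply/rowP=> k; rewrite mxE; apply: (inj (fun k => m k.1 0 k.2) _ (v, k)) => c.
  rewrite (sum_dot (fun v => a c v p)) -[RHS]((aE p m).2 (And3 mm mp m0) c).
  by apply: eq_bigr => u _; congr dot; apply/rowP=> j; rewrite mxE.
move=> p q /nrE /(line_open_inj ra q)[f f0 fP].
by exists f => // t /fP /nrE.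
Qed.

Lemma dangling_motion e g X p (c : V -> R) : on_lines g X p ->
  motion e g X p (fun v => c v *: p v).
Proof.
move=> Wp; split=> [x y _ _ _|v vX r rv]; last by rewrite dotZl (Wp v) ?mulr0.
by rewrite dotBl !dotZl dot_crossl dot_crossr !mulr0 subrr.
Qed.

(** Any motion becomes normalized after subtracting its projections onto the [p v], which form a
    motion because the points lie on their lines. *)
Lemma rigid_normalP e g X p : on_lines g X p ->
  rigid e g X p <-> (forall v, v \in X -> p v != 0) /\ normal_rigid e g X p.
Proof.
move=> Wp; split=> [[p0 rp]|[p0 nrp]]; split=> // m mm.
  move=> mp m0 v; have [vX|/m0//] := boolP (v \in X).
  by rewrite (cross0_scale (p0 v vX) (rp m mm v vX)) (mp v vX) mul0r scale0r.
pose c v := dot (m v) (p v) / dot (p v) (p v).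
pose m' v := if v \in X then m v - c v *: p v else 0.
have m'0 v : v \in X -> m' v = 0.
  move=> _; apply: nrp v => [|v vX|v /negbTE vX]; last by rewrite /m' vX.
    have [me ml] := mm; have [ce cl] := dangling_motion e c Wp.
    split=> [x y xX yX exy|v vX r rv]; rewrite /m'.
      have := me x y xX yX exy; have := ce x y xX yX exy.
      by rewrite xX yX !dotBl; lra.
    by rewrite vX dotBl ml // cl // subrr.
  by rewrite /m' vX dotBl dotZl divfK ?subrr // dot_eq0 p0.
move=> v vX; have := m'0 v vX; rewrite /m' vX => /eqP; rewrite subr_eq0 => /eqP->.
by rewrite crossZl cross_self scaler0.
Qed.

(** Rigidity, nonvanishing of the points and [P] are open and each can be met on the same lines,
    hence they can be met together. *)
Lemma realizable_generic e g X (P : config -> Prop) : line_open P ->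
  realizable e g X -> (exists2 p, on_lines g X p & P p) ->
  exists p, [/\ on_lines g X p, rigid e g X p & P p].
Proof.
move=> oP [p Wp /(rigid_normalP e Wp)[p0 nrp]] exP.
pose N v p := v \in X -> p v != 0.
have oN v : line_open (N v) by exact/line_open_imply/line_open_vneq0/vregular_coord.
have [|v|q Wq Nq] := line_open_all (@line_closed_on_lines g X) oN.
- by exists p.
- by exists p => // vX; exact: p0.
have oPN := line_openI oP (@line_open_normal_rigid e g X).
have [] := @line_open_all _ _ (option V) (on_lines g X)
  (fun o => if o is Some v then N v else fun p => P p /\ normal_rigid e g X p)
    (@line_closed_on_lines g X).
- by case.
- by exists p.
- case=> [v|]; first by exists q.
  by apply: line_open_meet (@line_closed_on_lines g X) oP _ exP _;
    [exact: line_open_normal_rigid | exists p].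
move=> r Wr H; have [Pr nr] := H None.
exists r; split=> //; apply/rigid_normalP => //; split=> // v; exact: (H (Some v)).
Qed.

End Realization.

(** * Henneberg steps *)

Section Henneberg.
Variables (R : realFieldType) (V I : finType) (l : I -> 'rV[R]_3).
Hypotheses (l_neq0 : forall r, l r != 0)
  (l_pair : forall r s, r != s -> cross (l r) (l s) != 0)
  (l_triple : forall r s t, uniq [:: r; s; t] -> dot (l r) (cross (l s) (l t)) != 0).
Local Notation config := {ffun V -> 'rV[R]_3}.
Implicit Types (p q : config) (m : V -> 'rV[R]_3) (X Y : {set V}).
Implicit Types (e : rel V) (g : V -> {set I}) (u : 'rV[R]_3).

Definition disjoint_on g X := forall x y r,
  x \in X -> y \in X -> r \in g x -> r \in g y -> x = y.

Definition on_all (A : {set I}) u := forall r, r \in A -> dot u (l r) = 0.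

Definition upd p v u : config := [ffun x => if x == v then u else p x].

Lemma updE p v u : upd p v u v = u.
Proof. by rewrite ffunE eqxx. Qed.

Lemma upd_neq p v u x : x != v -> upd p v u x = p x.
Proof. by rewrite ffunE => /negbTE->. Qed.

Lemma on_lines_upd g X p v u :
  on_lines l g (X :\ v) p -> on_all (g v) u -> on_lines l g X (upd p v u).
Proof.
move=> Wp Wu x xX r rx; have [xv|xv] := eqVneq x v.
  by rewrite xv updE Wu // -xv.
by rewrite upd_neq // (Wp x) // !inE xv.
Qed.

Lemma on_lines_subset g X Y p : Y \subset X -> on_lines l g X p -> on_lines l g Y p.
Proof. by move=> /subsetP sYX Wp v /sYX; exact: Wp. Qed.

Lemma on_lines0 g X : on_lines l g X 0.
Proof. by move=> v _ r _; rewrite ffunE dot0l. Qed.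

Lemma card_le2P (A : {set I}) : (#|A| <= 2)%N ->
  [\/ A = set0, exists s, A = [set s] | exists s t, s != t /\ A = [set s; t]].
Proof.
case cA: #|A| => [|[|[|//]]] _.
- by constructor 1; apply/eqP; rewrite -cards_eq0 cA.
- by constructor 2; apply/cards1P; rewrite cA.
- by constructor 3; apply/cards2P; rewrite cA.
Qed.

Lemma card1_eq (A : {set I}) s t : #|A| = 1%N -> s \in A -> t \in A -> s = t.
Proof. by move/eqP/cards1P=> [r ->] /set1P-> /set1P->. Qed.

Lemma exists_on_all (A : {set I}) : (#|A| <= 2)%N -> exists2 u, u != 0 & on_all A u.
Proof.
case/card_le2P=> [->|[s ->]|[s [t [_ ->]]]].
- by have [u [u0 _ _]] := exists_orth2 (0 : 'rV[R]_3) 0; exists u => // r; rewrite inE.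
- have [u [u0 us _]] := exists_orth2 (l s) (l s).
  by exists u => // r; rewrite inE => /eqP->.
- have [u [u0 us ut]] := exists_orth2 (l s) (l t).
  by exists u => // r; rewrite !inE => /orP[]/eqP->.
Qed.

(** This is where general position enters: a point confined to at most two lines can avoid any
    further one. With two lines it is their intersection. *)
Lemma exists_on_all_off (A : {set I}) r : (#|A| <= 2)%N -> r \notin A ->
  exists2 u, on_all A u & dot u (l r) != 0.
Proof.
case/card_le2P=> [->|[s ->]|[s [t [st ->]]]] rA.
- by exists (l r); rewrite ?dot_eq0 // => s; rewrite inE.
- have [|u us ur] := @exists_orth_dot _ (l s) (l r).
    by apply: l_pair; move: rA; rewrite inE eq_sym.
  by exists u => // t; rewrite inE => /eqP->.
- exists (cross (l s) (l t)).
    by move=> k; rewrite !inE dotC => /orP[]/eqP->; rewrite (dot_crossl, dot_crossr).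
  by rewrite dotC l_triple //; move: rA; rewrite /= !inE st !andbT.
Qed.

Lemma disjoint_onW g X x y r : disjoint_on g X ->
  x \in X -> y \in X -> x != y -> r \in g x -> r \notin g y.
Proof.
by move=> dg xX yX xy rx; apply: contra xy => ry; apply/eqP; exact: dg rx ry.
Qed.

Lemma generic_off g X x r : (#|g x| <= 2)%N -> r \notin g x ->
  exists2 p, on_lines l g X p & dot (p x) (l r) != 0.
Proof.
move=> gx rx; have [u Wu ur] := exists_on_all_off gx rx.
exists (upd 0 x u); last by rewrite updE.
by apply: on_lines_upd Wu; exact: on_lines0.
Qed.

Section Generic.
Variables (g : V -> {set I}) (X : {set V}).
Hypotheses (dg : disjoint_on g X) (g2 : forall v, v \in X -> (#|g v| <= 2)%N).

(** If [y] has a line, [x] is placed off it, as that line is not at [x]; otherwise [y] is free and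
    is chosen orthogonal to [x]. *)
Lemma generic_cross x y : x \in X -> y \in X -> x != y ->
  exists2 p, on_lines l g X p & cross (p x) (p y) != 0.
Proof.
move=> xX yX xy; have yx : y != x by rewrite eq_sym.
suff [u [v [Wu Wv uv]]] : exists u v,
    [/\ on_all (g x) u, on_all (g y) v & cross u v != 0].
  exists (upd (upd 0 y v) x u); last by rewrite updE upd_neq // updE.
  apply: on_lines_upd Wu; apply: on_lines_upd Wv; exact: on_lines0.
have [gy0|[r ry]] := set_0Vmem (g y).
  have [u u0 Wu] := exists_on_all (g2 xX).
  have [v [v0 vu _]] := exists_orth2 u u.
  exists u, v; split=> //; first by move=> r; rewrite gy0 inE.
  apply: contraNneq u0 => /(cross0_scale v0) ->.
  by rewrite dotC vu mul0r scale0r.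
have rx : r \notin g x by exact: (disjoint_onW dg yX xX yx ry).
have [u Wu ur] := exists_on_all_off (g2 xX) rx.
have [v v0 Wv] := exists_on_all (g2 yX).
exists u, v; split=> //; apply: contraNneq ur => /(cross0_scale v0) ->.
by rewrite dotZl Wv // mulr0.
Qed.

(* If [y] lies on a single line [l s], first move [x] off that line; then the
   line through [x] and [z] differs from [l s]. *)
Lemma generic_triple x y z : x \in X -> y \in X -> z \in X -> uniq [:: x; y; z] ->
  (#|g y| <= 1)%N ->
  exists2 p, on_lines l g X p & dot (p y) (cross (p x) (p z)) != 0.
Proof.
move=> xX yX zX; rewrite /= !inE negb_or andbT => /andP[/andP[xy xz] yz] gy1.
have [p Wp] : exists2 p, on_lines l g X p &
    cross (p x) (p z) != 0 /\ forall s, s \in g y -> dot (p x) (l s) != 0.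
  have [gy0|[s sy]] := set_0Vmem (g y).
    have [p Wp pxz] := generic_cross xX zX xz.
    by exists p => //; split=> // s; rewrite gy0 inE.
  have sx : s \notin g x by apply: (disjoint_onW dg yX xX _ sy); rewrite eq_sym.
  have [p Wp [pxz pxs]] := line_open_meet (@line_closed_on_lines _ _ _ l g X)
    (line_open_vneq0 (vregular_cross (vregular_coord x) (vregular_coord z)))
    (line_open_dot (vregular_coord x) (vregular_const (l s)))
    (generic_cross xX zX xz) (generic_off X (g2 xX) sx).
  exists p => //; split=> // t ty.
  by rewrite (_ : t = s) //; apply/eqP; move: gy1 => /card_le1_eqP/(_ t s ty sy)->.
set n := cross (p x) (p z); case=> n0 off.
have [u Wu un] : exists2 u, on_all (g y) u & dot u n != 0.
  have [gy0|[s sy]] := set_0Vmem (g y).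
    by exists n; [move=> s; rewrite gy0 inE | rewrite dot_eq0].
  have [|u us un] := @exists_orth_dot _ (l s) n.
    apply: contraNneq (off s sy) => /(cross0_scale n0) ->.
    by rewrite dotC dotZl (dotC n (p x)) dot_crossl mulr0.
  exists u => // t ty.
  by rewrite (_ : t = s) //; apply/eqP; move: gy1 => /card_le1_eqP/(_ t s ty sy)->.
exists (upd p y u); last by rewrite updE !upd_neq // eq_sym.
by apply: on_lines_upd Wu; apply: on_lines_subset Wp; exact: subsetDl.
Qed.

End Generic.

(** Common frame of all steps: a motion induces one of the smaller rigid framework, hence is trivial
    away from [v]; two independent conditions orthogonal to [u] then force [m v] to be parallel to
    [u]. *)
Lemma rigid_extend e g e' g' X v p u : v \in X ->
  on_lines l g (X :\ v) p -> rigid l e' g' (X :\ v) p ->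
  u != 0 -> on_all (g v) u ->
  (forall m, motion l e g X (upd p v u) m -> motion l e' g' (X :\ v) p m) ->
  (forall m, motion l e g X (upd p v u) m ->
     (forall x, x \in X :\ v -> cross (m x) (p x) = 0) ->
     exists l1 l2, [/\ cross l1 l2 != 0, dot (m v) l1 = 0, dot (m v) l2 = 0,
       dot u l1 = 0 & dot u l2 = 0]) ->
  realizable l e g X.
Proof.
move=> vX Wp [p0 rp] u0 Wu restr final.
exists (upd p v u); first exact: on_lines_upd.
split=> [x xX|m mm x xX]; have [->|xv] := eqVneq x v; rewrite ?updE ?upd_neq //.
- by apply: p0; rewrite !inE xv.
- have [l1 [l2 [l12 m1 m2 u1 u2]]] := final m mm (rp m (restr m mm)).
  exact: orth2_cross0 l12 m1 m2 u1 u2.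
- by apply: rp; rewrite ?inE ?xv //; exact: restr.
Qed.

Section Motion.
Variables (e : rel V) (g : V -> {set I}) (X : {set V}) (v : V).
Variables (p : config) (u : 'rV[R]_3) (m : V -> 'rV[R]_3).
Hypotheses (ie : irreflexive e) (vX : v \in X) (mm : motion l e g X (upd p v u) m).

Lemma motion_restrict : motion l e g (X :\ v) p m.
Proof.
have [me ml] := mm; split=> [x y|x].
  rewrite !inE => /andP[xv xX] /andP[yv yX] exy.
  by have := me x y xX yX exy; rewrite !upd_neq.
by rewrite !inE => /andP[_ xX] r; exact: ml.
Qed.

Lemma motion_edge x : x \in nbrs e X v ->
  dot (m v - m x) (cross u (p x)) = 0.
Proof.
rewrite inE => /andP[xX evx]; have := mm.1 v x vX xX evx.
rewrite updE upd_neq //; apply: contraTneq evx => ->.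
by rewrite ie.
Qed.

Lemma motion_edge_trivial x : x \in nbrs e X v -> cross (m x) (p x) = 0 ->
  dot (m v) (cross u (p x)) = 0.
Proof. by move=> /motion_edge + mx; rewrite dotBl (dot_cross0r u mx) subr0. Qed.

End Motion.

(** For [u] nonzero, the bars from [u] to [a] and [b] are independent exactly when the three points
    are not collinear. *)
Lemma cross_cross_same (u a b : 'rV[R]_3) :
  cross (cross u a) (cross u b) = dot u (cross a b) *: u.
Proof. by apply: row3P; rewrite /dot !mxE /=; ring. Qed.

(** * The five ways of putting a vertex back *)

Section Steps.
Variables (e : rel V) (g : V -> {set I}) (X : {set V}) (v : V).
Hypotheses (ie : irreflexive e) (vX : v \in X) (dg : disjoint_on g X)
  (g2 : forall x, x \in X -> (#|g x| <= 2)%N).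

Let sX : X :\ v \subset X. Proof. exact: subsetDl. Qed.
Let vX' : v \notin X :\ v. Proof. by rewrite !inE eqxx. Qed.
Let dg' : disjoint_on g (X :\ v).
Proof. by move=> x y r /(subsetP sX) xX /(subsetP sX) yX; exact: dg. Qed.
Let g2' x : x \in X :\ v -> (#|g x| <= 2)%N.
Proof. by move=> /(subsetP sX); exact: g2. Qed.
Let nbrX' x : x \in nbrs e X v -> x \in X :\ v.
Proof. by rewrite -nbrsD1 // inE => /andP[]. Qed.

(** The vertex goes to the intersection of its two lines, which alone pin it down. *)
Lemma realizable_02 : #|g v| = 2%N -> realizable l e g (X :\ v) -> realizable l e g X.
Proof.
move=> /eqP/cards2P[r [s [rs gv]]] [p Wp rp].
have u0 := l_pair rs.
apply: (rigid_extend vX Wp rp u0) => [t|m /motion_restrict|m mm _] //.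
  by rewrite gv !inE dotC => /orP[]/eqP->; rewrite (dot_crossl, dot_crossr).
exists (l r), (l s); rewrite u0 ![dot (cross _ _) _]dotC dot_crossl dot_crossr.
by split=> //; apply: mm.2; rewrite // gv !inE eqxx ?orbT.
Qed.

(** With [x] generically off [l r], any point of [l r] will do: its bar to [x] is transversal to
    [l r]. *)
Lemma realizable_11 r x : r \in g v -> #|g v| = 1%N -> x \in nbrs e X v ->
  realizable l e g (X :\ v) -> realizable l e g X.
Proof.
move=> rv g1 xN rX'; have xX' := nbrX' xN.
have xv : v != x by apply: contraNneq vX' => {1}->.
have rx := disjoint_onW dg vX (subsetP sX x xX') xv rv.
have [p [Wp rp pxr]] := realizable_generic
  (line_open_dot (vregular_coord x) (vregular_const (l r))) rX' (generic_off (X :\ v)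
    (g2' xX') rx).
have [u [u0 ur _]] := exists_orth2 (l r) (l r).
apply: (rigid_extend vX Wp rp u0) => [t tv|m /motion_restrict|m mm mX'] //.
  by rewrite (card1_eq g1 tv rv).
exists (l r), (cross u (p x)); rewrite dot_crossl ur; split=> //.
- rewrite cross_crossr [dot (l r) u]dotC ur scale0r subr0 scaler_eq0 negb_or u0.
  by rewrite dotC pxr.
- exact: mm.2.
- exact: (motion_edge_trivial ie vX mm xN (mX' x xX')).
Qed.

(** The vector [cross (p x) (p y)], taken as a point, is off the line of [x] and [y], since it pairs
    with itself to a nonzero value. *)
Lemma realizable_20 x y : g v = set0 -> x \in nbrs e X v -> y \in nbrs e X v ->
  x != y -> realizable l e g (X :\ v) -> realizable l e g X.
Proof.
move=> gv xN yN xy rX'; have [xX' yX'] := (nbrX' xN, nbrX' yN).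
have [p [Wp rp pxy]] := realizable_generic
  (line_open_vneq0 (vregular_cross (vregular_coord x) (vregular_coord y)))
  rX' (generic_cross dg' g2' xX' yX' xy).
apply: (rigid_extend vX Wp rp pxy) => [t|m /motion_restrict|m mm mX'] //.
  by rewrite gv inE.
set u := cross _ _ in mm *.
exists (cross u (p x)), (cross u (p y)); rewrite !dot_crossl cross_cross_same.
split=> //; first by rewrite scaler_eq0 dot_eq0 orbb.
- exact: (motion_edge_trivial ie vX mm xN (mX' x xX')).
- exact: (motion_edge_trivial ie vX mm yN (mX' y yX')).
Qed.

(* The new vertex is put on the line through [x] and [y]. *)
Lemma realizable_30 x y z : g v = set0 -> x \in nbrs e X v -> y \in nbrs e X v ->
  z \in nbrs e X v -> uniq [:: x; y; z] -> (#|g x| + #|g y| <= 3)%N ->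
  realizable l (add_edge e x y) g (X :\ v) -> realizable l e g X.
Proof.
move=> gv xN yN zN uxyz gxy rX'.
have [[xX' yX'] zX'] := (nbrX' xN, nbrX' yN, nbrX' zN).
have [p [Wp rp pzxy]] : exists p, [/\ on_lines l g (X :\ v) p,
    rigid l (add_edge e x y) g (X :\ v) p & dot (p z) (cross (p x) (p y)) != 0].
  apply: realizable_generic rX' _.
    by apply: line_open_dot; [|apply: vregular_cross]; exact: vregular_coord.
  (* [generic_triple] needs a point with at most one line; the bound on [#|g x| + #|g y|] makes [x]
     or [y] such a point. *)
  have [gy|gx] := leqP #|g y| 1.
    have [|p Wp pP] := generic_triple dg' g2' zX' yX' xX' _ gy.
      by move: uxyz; rewrite -(rev_uniq [:: x; y; z]).
    by exists p => //; rewrite 2!dot_cross_rot.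
  have gx1 : (#|g x| <= 1)%N by lia.
  have [|p Wp pP] := generic_triple dg' g2' yX' xX' zX' _ gx1.
    by move: uxyz; rewrite /= !inE !negb_or [y == x]eq_sym; case: (x == y);
      case: (x == z); case: (y == z).
  by exists p => //; rewrite dot_cross_rot.
(* A point of the line [xy] other than [x] and [y]: its bars to both are opposite multiples of
   [cross (p x) (p y)]. *)
set u := p x + p y.
have ux : cross u (p x) = cross (p y) (p x) by rewrite crossDl cross_self add0r.
have uy : cross u (p y) = cross (p x) (p y) by rewrite crossDl cross_self addr0.
have pxy : cross (p x) (p y) != 0 by apply: contraNneq pzxy => ->; rewrite dotC dot0l.
have u0 : u != 0 by apply: (@cross_neq0l _ _ (p y)); rewrite uy.
apply: (rigid_extend vX Wp rp u0) => [t|m mm|m mm mX'].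
- by rewrite gv inE.
- have [me ml] := motion_restrict mm; split=> // a b aX' bX'.
  (* Both bars at [v] act as the line [xy]; eliminating [m v] leaves the condition of the added
     edge. *)
  have hxy : dot (m x - m y) (cross (p x) (p y)) = 0.
    have := motion_edge ie vX mm xN; have := motion_edge ie vX mm yN.
    rewrite ux uy [cross (p y) _]crossC ![dot _ (- _)]dotC dotNl.
    by rewrite [dot (cross _ _) _]dotC !dotBl; lra.
  case/or3P=> [|/andP[/eqP-> /eqP->]|/andP[/eqP-> /eqP->]] //; first exact: me.
  by rewrite crossC -opprB dotNl dotC dotNl dotC hxy !oppr0.
exists (cross u (p x)), (cross u (p z)); rewrite !dot_crossl cross_cross_same.
split=> //.
- rewrite scaler_eq0 negb_or u0 andbT.
  have -> : dot u (cross (p x) (p z)) = - dot (p z) (cross (p x) (p y)).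
    by rewrite /u /dot !mxE /=; ring.
  by rewrite oppr_eq0.
- exact: (motion_edge_trivial ie vX mm xN (mX' x xX')).
- exact: (motion_edge_trivial ie vX mm zN (mX' z zX')).
Qed.

Definition move_line r x : V -> {set I} :=
  fun y => if y == x then r |: g y else g y.

(* The new vertex is put on [l r]; its bar to [x] then acts on [x] as [l r]. *)
Lemma realizable_21 r x y : r \in g v -> #|g v| = 1%N ->
  x \in nbrs e X v -> y \in nbrs e X v -> x != y ->
  realizable l e (move_line r x) (X :\ v) -> realizable l e g X.
Proof.
move=> rv g1 xN yN xy rX'; have [xX' yX'] := (nbrX' xN, nbrX' yN).
have [yx xv yv] : [/\ y != x, v != x & v != y].
  by rewrite eq_sym; split=> //; apply: contraNneq vX' => {1}->.
have ry : r \notin move_line r x y.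
  by rewrite /move_line (negbTE yx);
    exact: (disjoint_onW dg vX (subsetP sX y yX') yv rv).
have gy2 : (#|move_line r x y| <= 2)%N by rewrite /move_line (negbTE yx) g2'.
have [p [Wp rp pyr]] := realizable_generic
  (line_open_dot (vregular_coord y) (vregular_const (l r))) rX' (generic_off (X :\ v)
    gy2 ry).
have pxr : dot (p x) (l r) = 0 by apply: Wp; rewrite // /move_line eqxx !inE eqxx.
have px0 : p x != 0 by exact: rp.1.
(* The point of [l r] orthogonal to [p x], hence distinct from it. *)
set u := cross (l r) (p x).
have ux : cross u (p x) = - dot (p x) (p x) *: l r.
  by rewrite cross_crossl dotC pxr scale0r sub0r scaleNr.
have u0 : u != 0.
  apply: (@cross_neq0l _ _ (p x)).
  by rewrite ux scaler_eq0 oppr_eq0 dot_eq0 negb_or px0 l_neq0.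
have ur : dot u (l r) = 0 by rewrite dotC dot_crossl.
have Wp' : on_lines l g (X :\ v) p.
  by move=> a aX t ta; apply: Wp; rewrite // /move_line; case: eqP ta => // ->;
    rewrite !inE orbC => ->.
apply: (rigid_extend vX Wp' rp u0) => [t tv|m mm|m mm mX'].
- by rewrite (card1_eq g1 tv rv).
- have [me ml] := motion_restrict mm; split=> // a aX' t.
  rewrite /move_line; case: eqP => [ax|_]; last exact: ml.
  case/setU1P=> [->|ta]; last by apply: ml ta; rewrite -?ax.
  (* As [m v] is orthogonal to [l r] and the bar is a multiple of [l r], [m x] is orthogonal to
     [l r] too. *)
  have := motion_edge ie vX mm xN; rewrite ux dotC dotZl.
  move/eqP; rewrite mulf_eq0 oppr_eq0 dot_eq0 (negbTE px0) /= dotC dotBl.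
  by rewrite (mm.2 v vX r rv) sub0r oppr_eq0 ax => /eqP.
exists (l r), (cross u (p y)); rewrite dot_crossl ur; split=> //.
- rewrite cross_crossr [dot (l r) u]dotC ur scale0r subr0 scaler_eq0 negb_or u0.
  by rewrite dotC pyr.
- exact: mm.2.
- exact: (motion_edge_trivial ie vX mm yN (mX' y yX')).
Qed.

End Steps.

Theorem sparse_realizable e g X : symmetric e -> irreflexive e ->
  disjoint_on g X -> sparse e (fun v => #|g v|) X -> realizable l e g X.
Proof.
have [n] := ubnP #|X|; elim: n X e g => // n IHn X e g ltX se ie dg sp.
have [X0|X0] := eqVneq X set0.
  by exists 0; [exact: on_lines0 | split=> [v|m _ v]; rewrite X0 inE].
have g2 x : x \in X -> (#|g x| <= 2)%N by exact: (sparse_weight ie sp).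
have [v vX dv] := sparse_vertex se ie sp X0.
have ltX' : (#|X :\ v| < n)%N by rewrite (cardsD1 v) vX in ltX.
have dg' : disjoint_on g (X :\ v).
  by move=> x y r /setD1P[_ xX] /setD1P[_ yX]; exact: dg.
have IHd : #|nbrs e X v| + #|g v| = 2 -> realizable l e g (X :\ v).
  by move=> d2; apply: IHn => //; exact: sparse_delete.
move: dv; rewrite !inE !xpair_eqE.
case/or4P=> [/andP[/eqP dN /eqP dg_]|/andP[/eqP dN /eqP dg_]|/andP[/eqP dN /eqP
  dg_]|/orP[|]/andP[/eqP dN /eqP dg_]].
- by apply: (realizable_02 vX) => //; apply: IHd; rewrite dN dg_.
- have /eqP/cards1P[x Nx] := dN; have /eqP/cards1P[r gr] := dg_.
  have rv : r \in g v by rewrite gr inE.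
  have xN : x \in nbrs e X v by rewrite Nx inE.
  by apply: (realizable_11 ie vX dg g2 rv dg_ xN); apply: IHd; rewrite dN dg_.
- have /eqP/cards2P[x [y [xy Nxy]]] := dN; have /eqP := dg_;
    rewrite cards_eq0 => /eqP g0.
  have [xN yN] : x \in nbrs e X v /\ y \in nbrs e X v by rewrite Nxy !inE !eqxx orbT.
  by apply: (realizable_20 ie vX dg g2 g0 xN yN xy); apply: IHd; rewrite dN dg_.
- have [x [y [Nxy xy sp']]] := sparse_move_weight se ie sp vX dN dg_.
  have /eqP/cards1P[r gr] := dg_.
  have rv : r \in g v by rewrite gr inE.
  have [xN yN] : x \in nbrs e X v /\ y \in nbrs e X v by rewrite Nxy !inE !eqxx orbT.
  apply: (realizable_21 ie vX dg g2 rv dg_ xN yN xy).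
  have /setD1P[xv xX] : x \in X :\ v by move: xN; rewrite -nbrsD1 // inE => /andP[].
  have rx a : a \in X -> a != v -> r \notin g a.
    by move=> aX av; apply: (disjoint_onW dg vX aX _ rv); rewrite eq_sym.
  apply: IHn => //.
    (* The line handed over belonged to [v] only, which has been removed, so the lines stay
       disjoint. *)
    move=> a c t /setD1P[av aX] /setD1P[cv cX]; rewrite /move_line.
    case: eqP => [->|_]; case: eqP => [->//|_]; rewrite ?inE.
    - by case/orP=> [/eqP->|]; [rewrite (negbTE (rx _ _ _)) | exact: dg].
    - by move=> ta /orP[/eqP tr|]; [rewrite tr (negbTE (rx _ _ _)) in ta | exact: dg
        ta].
    - exact: dg.
  apply: eq_sparse sp' => a; rewrite /move_line; case: eqP => [->|_];
    last by rewrite addn0.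
  by rewrite cardsU1 rx // addnC.
- have [x [y [z [Nxyz uxyz nxy sp']]]] := sparse_split_edge se ie sp vX dN dg_.
  have /eqP := dg_; rewrite cards_eq0 => /eqP g0.
  have xy : x != y by move: uxyz => /= /andP[]; rewrite !inE negb_or => /andP[].
  have inX' a : a \in nbrs e X v -> a \in X :\ v by rewrite -nbrsD1 // inE => /andP[].
  have [xN [yN zN]] : x \in nbrs e X v /\ y \in nbrs e X v /\ z \in nbrs e X v.
    by rewrite Nxyz !inE !eqxx !orbT.
  apply: (realizable_30 ie vX dg g2 g0 xN yN zN uxyz).
    (* The weighted count on [[set x; y]] with its new edge yields the bound 3. *)
    have [_ spP _] := sp'.
    have := spP [set x; y]; rewrite subUset !sub1set !inX' // => /(_ isT).
    rewrite cards2 xy arcs_add_edge // !inE !eqxx orbT /weight big_setU1 ?inE //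
      big_set1.
    by rewrite /=; clear; lia.
  by apply: IHn => //; [exact: add_edge_sym | exact: add_edge_irr].
Qed.

End Henneberg.

(** * Counting arguments *)

Section Counting.
Variables (R : realFieldType) (V : finType).
Implicit Types (m p A : V -> 'rV[R]_3) (c : 'rV[R]_3).

Lemma underdetermined (C K : finType) (a : C -> K -> R) : (#|C| < #|K|)%N ->
  exists2 x : K -> R, forall i, \sum_k a i k * x k = 0 & exists k, x k != 0.
Proof.
move=> ltCK; pose M : 'M[R]_(#|K|, #|C|) := \matrix_(k, i) a (enum_val i) (enum_val k).
have /rowV0Pn[x /sub_kermxP xM x0] : kermx M != 0.
  rewrite -mxrank_eq0 mxrank_ker -lt0n subn_gt0.
  exact: leq_ltn_trans (rank_leq_col M) ltCK.
exists (fun k => x 0 (enum_rank k)) => [i|].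
  have /rowP/(_ (enum_rank i)) := xM; rewrite !mxE => xMi; rewrite -[RHS]xMi.
  rewrite [RHS](reindex _ (onW_bij _ (@enum_rank_bij K))) /=.
  by apply: eq_bigr => k _; rewrite mxE !enum_rankK mulrC.
have /rV0Pn[k xk] := x0.
by exists (enum_val k); rewrite enum_valK.
Qed.

Definition eval A m : R := \sum_v dot (A v) (m v).

Lemma eval_sum (C : finType) A (x : C -> R) (w : C -> V -> 'rV[R]_3) :
  eval A (fun v => \sum_i x i *: w i v) = \sum_i x i * eval A (w i).
Proof.
rewrite /eval; under [RHS]eq_bigr => i _ do rewrite big_distrr.
rewrite exchange_big; apply: eq_bigr => v _ /=.
elim/big_ind2: _ => [|u1 t1 u2 t2 <- <-|i _]; first by rewrite dotC dot0l.
  by rewrite dotC dotDl ![dot _ (A v)]dotC.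
by rewrite dotC dotZl dotC.
Qed.

Lemma exists_orth_pair (u : 'rV[R]_3) : u != 0 ->
  exists l : 'rV[R]_3 * 'rV[R]_3,
    [/\ cross l.1 l.2 != 0, dot u l.1 = 0 & dot u l.2 = 0].
Proof.
move=> u0; have [q [q0 qu _]] := exists_orth2 u u.
exists (q, cross u q); rewrite /= dot_crossl [dot u q]dotC qu; split=> //.
by rewrite cross_crossr qu scale0r subr0 scaler_eq0 negb_or dot_eq0 q0.
Qed.

(** Normalization uses up [#|V|] of the [3 * #|V|] degrees of freedom, leaving [2 * #|V|] against
    the [A i]. *)
Lemma exists_normal_motion (C : finType) (A : C -> V -> 'rV[R]_3) p :
  (#|C| < 2 * #|V|)%N -> exists m,
    [/\ forall i, eval (A i) m = 0, forall v, dot (m v) (p v) = 0 & exists v, m v != 0].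
Proof.
move=> ltCV.
pose a (j : C + V) v := match j with inl i => A i v | inr u => (v == u)%:R *: p v end.
have [|x xa [[v k] xvk]] :=
    @underdetermined (C + V)%type (V * 'I_3)%type (fun j k => a j k.1 0 k.2).
  by rewrite card_sum card_prod card_ord; lia.
exists (fun v => \row_k x (v, k)); split=> [i|u|].
- by have := xa (inl i); rewrite sum_dot.
- have := xa (inr u); rewrite sum_dot (bigD1 u) //= eqxx scale1r big1 ?addr0.
    by rewrite dotC.
  by move=> t /negbTE->; rewrite scale0r dot0l.
- by exists v; apply: contraNneq xvk => /rowP/(_ k); rewrite !mxE => ->.
Qed.

(* The unknowns are the coefficients of a combination of the dual vectors [w]
   and a vector [c]; a nonzero solution would be killed by every [A i]. *)
Lemma dual_family_count (C : finType) (A w : C -> V -> 'rV[R]_3) p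
    (Y : {set V}) (s : seq 'rV[R]_3) :
  (forall i, eval (A i) (w i) != 0) ->
  (forall i j, i != j -> eval (A i) (w j) = 0) ->
  (forall v, v \in Y -> p v != 0) ->
  (forall m c, (forall a, a \in s -> dot c a = 0) ->
     (forall v, v \in Y -> cross (m v - c) (p v) = 0) -> forall i, eval (A i) m = 0) ->
  (forall c, (forall a, a \in s -> dot c a = 0) ->
     (forall v, v \in Y -> cross c (p v) = 0) -> c = 0) ->
  (#|C| + 3 <= 2 * #|Y| + size s)%N.
Proof.
move=> wii wij p0 killA inj; rewrite leqNgt; apply/negP => lt.
pose Y' := {v | v \in Y}.
have [l lP] : exists l : Y' -> 'rV[R]_3 * 'rV[R]_3, forall v : Y',
    [/\ cross (l v).1 (l v).2 != 0, dot (p (val v)) (l v).1 = 0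
      & dot (p (val v)) (l v).2 = 0].
  by apply: (fin_all_exists (P := fun (v : Y') (lv : 'rV[R]_3 * 'rV[R]_3) =>
    [/\ cross lv.1 lv.2 != 0, dot (p (val v)) lv.1 = 0 & dot (p (val v)) lv.2 = 0]))
    => v; apply: exists_orth_pair; exact/p0/valP.
pose lb (v : Y') (b : bool) := if b then (l v).1 else (l v).2.
(* Two equations per vertex of [Y] make [m - c] parallel to [p] there, and one per element of [s]
   constrains [c]; the unknowns number [#|C| + 3]. *)
pose a (j : Y' * bool + 'I_(size s)) (k : C + 'I_3) : R := match j, k with
  | inl (v, b), inl i => dot (w i (val v)) (lb v b)
  | inl (v, b), inr k => - lb v b 0 k
  | inr n, inl i => 0
  | inr n, inr k => s`_n 0 k
  end.
have [|x xa [k0 xk0]] := @underdetermined _ _ a.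
  have cY : #|{: Y'}| = #|Y| by rewrite card_sig; apply: eq_card.
  by rewrite !card_sum card_prod card_bool !card_ord cY; lia.
pose c : 'rV[R]_3 := \row_k x (inr k).
pose m v := \sum_i x (inl i) *: w i v.
have sumk (u : 'rV[R]_3) : \sum_(k < 3) u 0 k * x (inr k) = dot u c.
  rewrite !big_ord_recl big_ord0 addr0 addrA /dot !mxE.
  have -> : lift ord0 ord0 = 1 :> 'I_3 by apply/val_inj.
  by have -> : lift ord0 (lift ord0 ord0) = 2 :> 'I_3 by apply/val_inj.
have dotm v u : dot (m v) u = \sum_i dot (w i v) u * x (inl i).
  rewrite /m; elim/big_ind2: _ => [|u1 t1 u2 t2 <- <-|i _]; first exact: dot0l.
    exact: dotDl.
  by rewrite dotZl mulrC.
have sc n : n \in s -> dot c n = 0.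
  move=> /(nthP 0)[i lti <-].
  have := xa (inr (Ordinal lti)); rewrite big_sumType /= big1 ?add0r.
    by rewrite sumk dotC.
  by move=> j _; rewrite mul0r.
have mc v : v \in Y -> cross (m v - c) (p v) = 0.
  move=> vY; pose v' : Y' := Sub v vY.
  have mcb b : dot (m v - c) (lb v' b) = 0.
    have := xa (inl (v', b)); rewrite big_sumType /= -dotm.
    under [X in _ + X]eq_bigr => k _ do rewrite mulNr.
    by rewrite sumrN sumk dotBl [dot c _]dotC.
  have [l12 l1 l2] := lP v'.
  exact: orth2_cross0 l12 (mcb true) (mcb false) l1 l2.
have x0 i : x (inl i) = 0.
  have := killA m c sc mc i; rewrite eval_sum (bigD1 i) //= big1 ?addr0.
    by move/eqP; rewrite mulf_eq0 (negbTE (wii i)) orbF => /eqP.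
  by move=> j ji; rewrite wij ?mulr0 // eq_sym.
have c0 : c = 0.
  apply: inj => // v /mc; rewrite {1}/m big1 ?sub0r => [|i _].
    by move/eqP; rewrite -scaleN1r crossZl scaleN1r oppr_eq0 => /eqP.
  by rewrite x0 scale0r.
case: k0 xk0 => [i|k]; first by rewrite x0 eqxx.
by have /rowP/(_ k) := c0; rewrite !mxE => ->; rewrite eqxx.
Qed.

End Counting.

(** * Necessity *)

Section Lines.
Variable R : realType.
Implicit Types (x y b c : 'rV[R]_3).

Lemma hodgeZ (k : R) c : hodge (k *: c) = k *: hodge c.
Proof. by apply: row3P; rewrite !mxE /=; ring. Qed.

Lemma hodge_inj : injective (@hodge R).
Proof.
move=> x y /rowP hxy; apply: row3P.
- by have := hxy 2; rewrite !mxE.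
- by have := hxy 1; rewrite !mxE /= => /oppr_inj.
- by have := hxy 0; rewrite !mxE.
Qed.

Lemma hodge0 : hodge (0 : 'rV[R]_3) = 0.
Proof. by apply: row3P; rewrite !mxE /= ?oppr0. Qed.

Lemma hodge_eq0 c : (hodge c == 0) = (c == 0).
Proof. by rewrite -[RHS](inj_eq hodge_inj) hodge0. Qed.

Lemma pairing_sumr (T : Type) (s : seq T) (k : T -> R) (u : T -> 'rV[R]_3) c :
  pairing c (\sum_(i <- s) k i *: u i) = \sum_(i <- s) k i * pairing c (u i).
Proof.
elim/big_ind2: _ => [|u1 t1 u2 t2 <- <-|i _]; rewrite !pairingE.
- by rewrite /dot !mxE /=; ring.
- by rewrite /dot !mxE /=; ring.
- by rewrite hodgeZ dotC dotZl dotC.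
Qed.

Lemma line_eq_cross0 x y : x != 0 -> y != 0 -> cross x y = 0 -> <[x]>%VS = <[y]>%VS.
Proof.
move=> x0 y0 cxy; apply/eqP; rewrite eqEsubv -!memvE.
have cyx : cross y x = 0 by apply/eqP; rewrite cross_eq0C cxy.
apply/andP; split; first by rewrite (cross0_scale y0 cxy) memvZ ?memv_line.
by rewrite (cross0_scale x0 cyx) memvZ ?memv_line.
Qed.

Lemma cross0_line_eq x y : <[x]>%VS = <[y]>%VS -> cross x y = 0.
Proof.
move=> xy; have /vlineP[k ->] : x \in <[y]>%VS by rewrite -xy memv_line.
by rewrite crossZl cross_self scaler0.
Qed.

End Lines.

Section Bars.
Variables (R : realType) (V E I : finType) (ends : E -> V * V) (at_ : I -> V).
Variables (b : I -> 'rV[R]_3) (p : V -> 'rV[R]_3).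
Implicit Types (m : V -> 'rV[R]_3) (F : {set E}) (S : {set I}).

(** The rows of the rigidity matrix, edges and boundary bars being treated alike. *)
Definition bar_row (x : E + I) (v : V) : 'rV[R]_3 := match x with
  | inl e => (v == (ends e).1)%:R *: hodge (bar ends p e)
             - (v == (ends e).2)%:R *: hodge (bar ends p e)
  | inr r => (v == at_ r)%:R *: hodge (b r)
  end.

Lemma eval_edge e m :
  eval (bar_row (inl e)) m = pairing (m (ends e).1 - m (ends e).2) (bar ends p e).
Proof.
rewrite pairingE dotBl /eval /=; under eq_bigr => v _ do rewrite dotBl.
have single u : \sum_v dot ((v == u)%:R *: hodge (bar ends p e)) (m v)
    = dot (m u) (hodge (bar ends p e)).
  by have := sum_dot_single u true (hodge (bar ends p e)) m; rewrite mul1r dotC.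
by rewrite sumrB !single.
Qed.

Lemma eval_boundary r m : eval (bar_row (inr r)) m = pairing (m (at_ r)) (b r).
Proof.
have := sum_dot_single (at_ r) true (hodge (b r)) m.
by rewrite mul1r pairingE dotC.
Qed.

Lemma infinitesimal_motionE F S m : infinitesimal_motion ends at_ p b F S m <->
  (forall e, e \in F -> eval (bar_row (inl e)) m = 0) /\
  (forall r, r \in S -> eval (bar_row (inr r)) m = 0).
Proof.
split=> -[me ml]; split=> [e eF|]; rewrite ?eval_edge; try exact: me.
- by move=> r rS; rewrite eval_boundary; apply: ml; rewrite // inE.
- by have := me e eF; rewrite eval_edge.
- by move=> v r; rewrite inE => /eqP <- rS; rewrite -eval_boundary; exact: ml.
Qed.

Lemma dangling_sum (c : V -> R) u :
  \sum_v c v *: trivial_dangling p v u = c u *: p u.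
Proof.
rewrite (bigD1 u) //= /trivial_dangling eqxx big1 ?addr0 // => v vu.
by rewrite eq_sym (negbTE vu) scaler0.
Qed.

Hypothesis p0 : forall v, p v != 0.

Lemma infinitesimally_rigidE F S : infinitesimally_rigid ends at_ p b F S <->
  forall m, infinitesimal_motion ends at_ p b F S m -> forall v, cross (m v) (p v) = 0.
Proof.
split=> rig m /rig.
  by case=> c mE v; rewrite mE dangling_sum crossZl cross_self scaler0.
move=> mp; exists (fun v => dot (m v) (p v) / dot (p v) (p v)) => u.
by rewrite dangling_sum; exact: cross0_scale.
Qed.

Lemma not_rigid_few_bars F S :
  (#|F| + #|S| < 2 * #|V|)%N -> ~ infinitesimally_rigid ends at_ p b F S.
Proof.
move=> lt /infinitesimally_rigidE rig.
pose bars := ({e | e \in F} + {r | r \in S})%type.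
pose A (x : bars) := bar_row (match x with inl e => inl (val e) | inr r => inr (val r)
  end).
have cF : #|{: {e | e \in F}}| = #|F| by rewrite card_sig; apply: eq_card.
have cS : #|{: {r | r \in S}}| = #|S| by rewrite card_sig; apply: eq_card.
have [|m [Am mp [v mv]]] := @exists_normal_motion _ _ _ A p.
  by rewrite card_sum cF cS.
have mm : infinitesimal_motion ends at_ p b F S m.
  apply/infinitesimal_motionE; split=> [e eF|r rS].
    exact: (Am (inl (Sub e eF))).
  exact: (Am (inr (Sub r rS))).
move: mv; rewrite (cross0_scale (p0 v) (rig m mm v)) mp mul0r scale0r.
by rewrite eqxx.
Qed.

(** Removing any bar leaves fewer than [2 * #|V|], too few for rigidity. *)
Lemma rigid_minimal : infinitesimally_rigid ends at_ p b setT setT ->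
  (#|E| + #|I| = 2 * #|V|)%N -> minimally_infinitesimally_rigid ends at_ p b.
Proof.
move=> rig cEI; split=> // x; apply: not_rigid_few_bars; rewrite cardsT cardsC1.
  by have : (0 < #|E|)%N by [apply/card_gt0P; exists x]; move: cEI; clear; lia.
by have : (0 < #|I|)%N by [apply/card_gt0P; exists x]; move: cEI; clear; lia.
Qed.

(** * Counts forced by minimal rigidity *)

Section Minimal.
Hypotheses (p_inj : injective (fun v => <[p v]>%VS))
  (p_lines : forall v r, r \in boundary_at at_ v -> pairing (p v) (b r) = 0)
  (min_rigid : minimally_infinitesimally_rigid ends at_ p b).

(** If every motion of the framework without a bar were also killed by that bar, removing it would
    preserve rigidity. *)
Lemma dual_motions : exists w : E + I -> V -> 'rV[R]_3,
  (forall x, eval (bar_row x) (w x) != 0) /\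
  (forall x y, x != y -> eval (bar_row x) (w y) = 0).
Proof.
have [rig minE minI] := min_rigid.
have motionT m : (forall x, eval (bar_row x) m = 0) -> exists c, forall u, m u = \sum_v
  c v *: trivial_dangling p v u.
  by move=> H; apply: rig; apply/infinitesimal_motionE; split=> *; exact: H.
have ex y : exists w, eval (bar_row y) w != 0 /\ forall x, x != y -> eval (bar_row x) w
  = 0.
  apply: contrapT => no; case: y no => [e|r] no.
    apply: (minE e) => m /infinitesimal_motionE[me ml]; apply: motionT => x.
    have mx z : z != inl e -> eval (bar_row z) m = 0.
      by case: z => [e'|r'] zx; [apply: me; rewrite !inE | apply: ml].
    have [->|/mx//] := eqVneq x (inl e).
    by apply: contrapT => /eqP mex; apply: no; exists m.
  apply: (minI r) => m /infinitesimal_motionE[me ml]; apply: motionT => x.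
  have mx z : z != inr r -> eval (bar_row z) m = 0.
    by case: z => [e'|r'] zx; [apply: me | apply: ml; rewrite !inE].
  have [->|/mx//] := eqVneq x (inr r).
  by apply: contrapT => /eqP mex; apply: no; exists m.
have [w wP] := fin_all_exists ex.
by exists w; split=> [x|x y xy]; [have [] := wP x | have [_ ->] := wP y].
Qed.

Lemma cross_points x y : x != y -> cross (p x) (p y) != 0.
Proof.
apply: contraNneq => /(line_eq_cross0 (p0 x) (p0 y)) pxy.
by apply/eqP; exact: p_inj.
Qed.

(** The bars of [F] and [S] kill whatever is a common vector [c] on [Y] up to danglings: [c] cancels
    along edges, and the conditions [s] kill it on [S]. *)
Lemma bars_subset_count (F : {set E}) (S : {set I}) (Y : {set V}) (s : seq 'rV[R]_3) :
  (forall e, e \in F -> (ends e).1 \in Y /\ (ends e).2 \in Y) ->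
  (forall r, r \in S -> at_ r \in Y) ->
  (forall c, (forall a, a \in s -> dot c a = 0) -> forall r, r \in S -> pairing c (b r)
    = 0) ->
  (forall c, (forall a, a \in s -> dot c a = 0) ->
     (forall v, v \in Y -> cross c (p v) = 0) -> c = 0) ->
  (#|F| + #|S| + 3 <= 2 * #|Y| + size s)%N.
Proof.
move=> FY SY sS inj; have [w [wxx wxy]] := dual_motions.
pose bars := ({e | e \in F} + {r | r \in S})%type.
pose h (x : bars) : E + I := match x with inl e => inl (val e) | inr r => inr (val r)
  end.
have h_inj : injective h.
  by move=> [x|x] [y|y] // [] /val_inj ->.
have cF : #|{: {e | e \in F}}| = #|F| by rewrite card_sig; apply: eq_card.
have cS : #|{: {r | r \in S}}| = #|S| by rewrite card_sig; apply: eq_card.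
have := @dual_family_count _ _ bars (bar_row \o h) (w \o h) p Y s.
rewrite card_sum cF cS; apply=> //= [x y xy|m c sc mc x].
  by apply: wxy; rewrite (inj_eq h_inj).
case: x => -[x /= xF].
  rewrite eval_edge pairingE hodge_wedge.
  have [xY yY] := FY x xF.
  have := dot_cross0l (p (ends x).2) (mc _ xY).
  have := dot_cross0r (p (ends x).1) (mc _ yY).
  by rewrite !dotBl; lra.
rewrite eval_boundary; have xY := SY x xF.
have := sS c sc x xF; rewrite !pairingE => cx.
have := p_lines (v := at_ x) (r := x); rewrite inE eqxx => /(_ isT).
rewrite pairingE => px.
have : dot (m (at_ x) - c) (hodge (b x)) = 0.
  by rewrite (cross0_scale (p0 _) (mc _ xY)) dotZl px mulr0.
by rewrite dotBl cx subr0.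
Qed.

(** Using a basis as [s] forces [c = 0], and the two 3's in the count cancel. *)
Let basis3 : seq 'rV[R]_3 := [:: delta_mx 0 0; delta_mx 0 1; delta_mx 0 2].

Let basis3P c : (forall a, a \in basis3 -> dot c a = 0) -> c = 0.
Proof.
move=> H; apply: row3P; rewrite mxE.
- have := H (delta_mx 0 0); rewrite !inE eqxx => /(_ isT).
  by rewrite /dot !mxE /= !mulr0 mulr1 !addr0.
- have := H (delta_mx 0 1); rewrite !inE eqxx orbT => /(_ isT).
  by rewrite /dot !mxE /= !mulr0 mulr1 addr0 add0r.
- have := H (delta_mx 0 2); rewrite !inE eqxx !orbT => /(_ isT).
  by rewrite /dot !mxE /= !mulr0 mulr1 !add0r.
Qed.

Lemma minimal_card : (#|E| + #|I| = 2 * #|V|)%N.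
Proof.
have [rig _ _] := min_rigid.
apply/eqP; rewrite eqn_leq; apply/andP; split; last first.
  rewrite leqNgt; apply/negP => lt; apply: not_rigid_few_bars rig.
  by rewrite !cardsT.
have := @bars_subset_count setT setT setT basis3.
rewrite !cardsT /= leq_add2r; apply=> //.
  by move=> c /basis3P-> r _; rewrite pairingE dot0l.
by move=> c /basis3P.
Qed.

Lemma minimal_boundary_card v : (#|boundary_at at_ v| <= 2)%N.
Proof.
have := @bars_subset_count set0 (boundary_at at_ v) [set v] basis3.
rewrite cards0 cards1 add0n leq_add2r; apply=> //.
- by move=> e; rewrite in_set0.
- by move=> r; rewrite !inE.
- by move=> c /basis3P-> r _; rewrite pairingE dot0l.
- by move=> c /basis3P.
Qed.

(** Pairing a linear relation with the dual motion of one bar at [v] isolates the coefficient of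
    that bar. *)
Lemma minimal_boundary_free v : free [seq b r | r in boundary_at at_ v].
Proof.
have [w [wxx wxy]] := dual_motions.
set A := boundary_at at_ v.
have sz : size [seq b r | r in A] == #|A| by rewrite size_image.
change (free (Tuple sz)); apply/freeP => k k0 i.
pose x (j : 'I_#|A|) : I := enum_val j.
have xA j : at_ (x j) = v by have : x j \in A := enum_valP j; rewrite inE => /eqP.
have : pairing (w (inr (x i)) v) (\sum_(i < #|A|) k i *: b (x i)) = 0.
  rewrite -[RHS](_ : pairing (w (inr (x i)) v) 0 = 0).
    congr pairing; rewrite -[RHS]k0; apply: eq_bigr => j _; congr (_ *: _).
    by rewrite /= nth_image.
  by rewrite pairingE hodge0 dotC dot0l.
have pw j : pairing (w (inr (x i)) v) (b (x j)) = eval (bar_row (inr (x j))) (w (inr (x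
  i))).
  by rewrite eval_boundary xA.
rewrite pairing_sumr (bigD1 i) //= big1 ?addr0 => [|j ji].
  by rewrite pw => /eqP; rewrite mulf_eq0 (negbTE (wxx _)) orbF => /eqP.
rewrite pw wxy ?mulr0 //; apply: contraNneq ji => -[] /enum_val_inj ->.
by [].
Qed.

(** Take for [s] the duals of a basis of the span of the lines, so that [size s] is the dimension. A
    vector [c] parallel to the distinct end points of an edge vanishes. *)
Lemma minimal_sparse (F : {set E}) : F != set0 ->
  (#|F| + #|boundary_of ends at_ F| + 3 <= 2 * #|edge_verts ends F|
     + \dim <<[seq b r | r in boundary_of ends at_ F]>>)%N.
Proof.
move=> /set0Pn[e eF]; have [w [wxx wxy]] := dual_motions.
set S := boundary_of ends at_ F; set B := <<_>>%VS.
have in_ends e' : e' \in F -> (ends e').1 \in edge_verts ends F /\ (ends e').2 \in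
  edge_verts ends F.
  by move=> e'F; split; rewrite inE; apply/existsP; exists e'; rewrite e'F eqxx ?orbT.
have := @bars_subset_count F S (edge_verts ends F) [seq hodge a | a <- vbasis B].
rewrite size_map size_tuple; apply=> // [r|c sc r rS|c _ cp].
- by rewrite inE.
- have rB : b r \in B by apply: memv_span; apply/imageP; exists r.
  rewrite (coord_vbasis rB) pairing_sumr big1 // => i _.
  rewrite pairingE sc ?mulr0 //; apply: map_f.
  by rewrite mem_nth // size_tuple.
have [xY yY] := in_ends e eF.
(* Every motion vanishes on a loop, so a loop has no dual motion. *)
have exy : (ends e).1 != (ends e).2.
  apply: contraNneq (wxx (inl e)) => exy; rewrite eval_edge exy subrr.
  by rewrite pairingE dot0l.
have cE := cross0_scale (p0 _) (cp _ xY).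
move: (cp _ yY); rewrite cE crossZl => /eqP.
by rewrite scaler_eq0 (negbTE (cross_points exy)) orbF => /eqP ->; rewrite scale0r.
Qed.

End Minimal.
End Bars.

(** * Sufficiency *)

Section Sufficiency.
Variables (R : realType) (V E I : finType) (ends : E -> V * V) (at_ : I -> V).
Variable b : I -> 'rV[R]_3.
Hypotheses (b_lines : forall r, represents_line (b r)) (b_gen : general_position b).
Hypotheses
  (cond1 : forall v : V, (#|boundary_at at_ v| <= 2)%N /\
                    free [seq b r | r in boundary_at at_ v])
  (cond2 : forall F : {set E}, F != set0 ->
     (#|F| + #|boundary_of ends at_ F| + 3 <= 2 * #|edge_verts ends F|
       + \dim <<[seq b r | r in boundary_of ends at_ F]>>)%N)
  (cond3 : (#|E| + #|I| = 2 * #|V|)%N).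
Implicit Types (F : {set E}) (Y : {set V}).

Let adj (x y : V) : bool := [exists e, (ends e == (x, y)) || (ends e == (y, x))].

Let g := boundary_at at_.

Lemma weight_boundary Y : weight (fun v => #|g v|) Y = #|[set r | at_ r \in Y]|.
Proof.
rewrite -[RHS]sum1_card (partition_big at_ (mem Y)) /=; last by move=> r; rewrite inE.
apply: eq_bigr => v vY; rewrite -sum1_card; apply: eq_bigl => r.
by rewrite !inE; case: eqP => [->|]; rewrite ?andbF ?vY.
Qed.

(** The dimension is at most [#|S|] and at most 3; vertices of [Y] outside [V(F)] carry at most two
    lines each. *)
Lemma sparse_sub F Y : F != set0 -> edge_verts ends F \subset Y ->
  (#|F| + 3 <= 2 * #|Y|)%N /\ (#|F| + weight (fun v => #|g v|) Y <= 2 * #|Y|)%N.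
Proof.
move=> F0 sFY; have := cond2 F0; set S := boundary_of ends at_ F;
  set B := <<_>>%VS => le.
have dimS : (\dim B <= #|S|)%N by rewrite (leq_trans (dim_span _)) // size_image.
have dim3 : (\dim B <= 3)%N.
  by rewrite (leq_trans (dimvS (subvf _))) // dimvf /dim /= mul1n.
have cardY := subset_leq_card sFY.
have SE : #|S| = weight (fun v => #|g v|) (edge_verts ends F) by rewrite
  weight_boundary.
have : (weight (fun v => #|g v|) (Y :\: edge_verts ends F) <= 2 * #|Y :\: edge_verts
  ends F|)%N.
  rewrite mulnC -sum_nat_const; apply: leq_sum => v _; exact: (cond1 v).1.
have : weight (fun v => #|g v|) Y = (#|S| + weight (fun v => #|g v|) (Y :\: edge_verts
  ends F))%N.
  by rewrite SE /weight (big_setID (edge_verts ends F)) /= (setIidPr sFY).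
have := cardsID (edge_verts ends F) Y; rewrite (setIidPr sFY).
move: le dimS dim3 cardY; clear; lia.
Qed.

Let joining x y := [set e | (ends e == (x, y)) || (ends e == (y, x))].

(** The first count on one or two vertices excludes loops and parallel edges, so the passage to a
    simple graph loses nothing. *)
Lemma joining_card x y : #|joining x y| = adj x y /\ (x = y -> adj x y = false).
Proof.
have adjE : adj x y = (joining x y != set0).
  apply/existsP/set0Pn => -[e eE]; exists e; first by rewrite inE.
  by rewrite inE in eE.
have sub : edge_verts ends (joining x y) \subset [set x; y].
  apply/subsetP => v; rewrite inE => /existsP[e]; rewrite !inE => /andP[].
  by case/orP=> /eqP-> /=; rewrite // orbC.
have [/eqP J0|J0] := boolP (joining x y == set0).
  by rewrite adjE J0 eqxx cards0.
have [+ _] := sparse_sub J0 sub; rewrite adjE J0 cards2.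
have : (0 < #|joining x y|)%N by rewrite card_gt0.
have [->|xy] /= := eqVneq x y; first by clear; lia.
by move=> *; split=> [|xy']; [lia | rewrite xy' eqxx in xy].
Qed.

Lemma adj_sym : symmetric adj.
Proof. by move=> x y; apply: eq_existsb => e; rewrite orbC. Qed.

Lemma adj_irr : irreflexive adj.
Proof. by move=> x; rewrite (joining_card x x).2. Qed.

Lemma arcs_adj Y :
  arcs adj Y = (2 * #|[set e | ((ends e).1 \in Y) && ((ends e).2 \in Y)]|)%N.
Proof.
(* Summing [N] over all pairs, in either orientation, meets each edge once, whence the factor 2. *)
pose N (q : V * V) := #|[set e | ends e == q]|.
have adjN x y : adj x y = (N (x, y) + N (y, x))%N :> nat.
  have [cJ xy0] := joining_card x y.
  have [xy|xy] := eqVneq x y.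
    rewrite xy0 // /N xy addnn; move: cJ; rewrite xy0 // => /eqP.
    rewrite cards_eq0 /joining xy => /eqP J0.
    by rewrite (_ : [set e | ends e == (y, y)] = set0) ?cards0 // -J0; apply/setP=> e;
      rewrite !inE orbb.
  rewrite -cJ (_ : joining x y = [set e | ends e == (x, y)] :|: [set e | ends e == (y,
    x)]).
    rewrite cardsU (_ : _ :&: _ = set0) ?cards0 ?subn0 //.
    apply/setP=> e; rewrite !inE; apply/andP=> -[/eqP-> /eqP[xy' _]].
    by rewrite xy' eqxx in xy.
  by apply/setP=> e; rewrite !inE.
have half (h : V * V -> V * V) : involutive h -> (forall q, ((h q).1 \in Y) && ((h q).2
  \in Y) = (q.1 \in Y) && (q.2 \in Y)) ->
  (\sum_q ((q.1 \in Y) && (q.2 \in Y)) * N (h q) = #|[set e | ((ends e).1 \in Y) &&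
    ((ends e).2 \in Y)]|)%N.
  move=> hK hY; rewrite (reindex_inj (inv_inj hK)) /=.
  rewrite -sum1_card (partition_big ends predT) //=; apply: eq_bigr => q _.
  rewrite hK hY /N -[#|_|]sum1_card.
  have [qY|qY] := boolP (_ && _); rewrite ?mul1n ?mul0n.
    by apply: eq_bigl => e; rewrite !inE; case: eqP => [->|]; rewrite ?qY ?andbF.
  by rewrite big1 // => e; rewrite !inE => /andP[+ /eqP eq]; rewrite eq (negbTE qY).
rewrite mul2n -addnn -{1}(half id) // -(half (fun q => (q.2, q.1))).
- rewrite -big_split /= /arcs pair_bigA /=; apply: eq_bigr => -[x y] _ /=.
  by rewrite -mulnDr -adjN; case: (x \in Y); case: (y \in Y); rewrite ?mul1n.
- by case.
- by move=> q /=; rewrite andbC.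
Qed.

Lemma adj_sparse : sparse adj (fun v => #|g v|) setT.
Proof.
have subY Y : edge_verts ends [set e | ((ends e).1 \in Y) && ((ends e).2 \in Y)]
  \subset Y.
  apply/subsetP => v; rewrite inE => /existsP[e]; rewrite inE => /andP[/andP[e1 e2]].
  by case/orP=> /eqP->.
split=> [Y _ Y1|Y _|].
- rewrite arcs_adj; set F := [set e | _].
  have [F0|F0] := eqVneq F set0; first by rewrite F0 cards0; move: Y1; clear; lia.
  by have [+ _] := sparse_sub F0 (subY Y); rewrite -/F; clear; lia.
- rewrite arcs_adj; set F := [set e | _].
  have [F0|F0] := eqVneq F set0; last first.
    by have [_] := sparse_sub F0 (subY Y); rewrite -/F; clear; lia.
  have : (weight (fun v => #|g v|) Y <= 2 * #|Y|)%N.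
    by rewrite mulnC -sum_nat_const; apply: leq_sum => v _; exact: (cond1 v).1.
  by rewrite F0 cards0; clear; lia.
rewrite arcs_adj weight_boundary cardsT.
rewrite (_ : [set e | _] = setT); last by apply/setP=> e; rewrite !inE.
rewrite (_ : [set r | _] = setT); last by apply/setP=> r; rewrite !inE.
by rewrite !cardsT; move: cond3; clear; lia.
Qed.

Let l r := hodge (b r).

Lemma line_neq0 r : l r != 0.
Proof. by rewrite /l hodge_eq0; case: (b_lines r). Qed.

(* Without a third line, general position says nothing; then the counts force
   both lines to be at the same vertex. *)
Lemma line_pair r s : r != s -> cross (l r) (l s) != 0.
Proof.
move=> rs; apply/negP => /eqP crs.
have [/existsP[t /andP[tr ts]]|/existsPn only] := boolP [exists t, (t != r) && (t !=
  s)].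
  apply: (b_gen (r := r) (s := s) (t := t));
    first by rewrite /= !inE negb_or rs eq_sym tr eq_sym ts.
  (* The lines [l r] and [l s] coincide, so their intersection with [l t] lies on all three. *)
  have [a [a0 ar at0]] := exists_orth2 (l r) (l t).
  exists a; rewrite !pairingE; split=> //.
  have csr : cross (l s) (l r) = 0 by apply/eqP; rewrite cross_eq0C crs.
  by rewrite -/(l s) (cross0_scale (line_neq0 r) csr) dotC dotZl (dotC (l r) a) ar
    mulr0.
have cI : #|I| = 2.
  rewrite -cardsT (_ : setT = [set r; s]) ?cards2 ?rs //.
  by apply/setP=> t; have := only t; rewrite negb_and !negbK !inE.
(* With only two lines the dimension is at most 2, so (2) for all of [E] contradicts (3) unless [E]
   is empty; then [V] is a single vertex. *)
have atrs : at_ r = at_ s.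
  have [E0|[e _]] := set_0Vmem [set: E].
    have cV : (#|V| <= 1)%N by move: cond3; rewrite -cardsT E0 cards0 cI; clear; lia.
    by apply: (fintype_le1P cV).
  have T0 : [set: E] != set0 by apply/set0Pn; exists e; rewrite inE.
  have := cond2 T0.
  have : (#|[set: V]| = #|edge_verts ends setT| + #|~: edge_verts ends setT|)%N by
    rewrite cardsC cardsT.
  have : (weight (fun v => #|g v|) (~: edge_verts ends setT) <= 2 * #|~: edge_verts
    ends setT|)%N.
    by rewrite mulnC -sum_nat_const; apply: leq_sum => v _; exact: (cond1 v).1.
  have : (weight (fun v => #|g v|) (edge_verts ends setT) + weight (fun v => #|g v|)
    (~: edge_verts ends setT) = #|I|)%N.
    rewrite weight_modular setUCr setICr /weight big_set0 addn0 -/(weight _ _)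
      weight_boundary.
    by rewrite -cardsT; congr #|pred_of_set _|; apply/setP=> t; rewrite !inE.
  have -> : weight (fun v => #|g v|) (edge_verts ends setT) = #|boundary_of ends at_
    setT| by rewrite weight_boundary.
  set B := <<_>>%VS.
  have : (\dim B <= 2)%N.
    by rewrite (leq_trans (dim_span _)) // size_image (leq_trans (max_card _)) // cI.
  by rewrite !cardsT; move: cond3; rewrite cI; clear; lia.
have [_ fr] := cond1 (at_ r).
have : ([seq b t | t in boundary_at at_ (at_ r)] : seq _) =i [:: b r; b s].
  move=> c; rewrite !inE; apply/imageP/orP => [[t _ ->]|].
    by have := only t; rewrite negb_and !negbK => /orP[]/eqP->; rewrite eqxx;
      [left|right].
  by case=> /eqP->; [exists r | exists s]; rewrite // inE ?atrs.
move: fr; rewrite /free => /eqP fr /eq_span spE; move: fr; rewrite spE size_image.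
have -> : #|boundary_at at_ (at_ r)| = 2.
  rewrite -cI -cardsT; congr #|pred_of_set _|; apply/setP=> t; rewrite !inE.
  by have := only t; rewrite negb_and !negbK => /orP[]/eqP->; rewrite ?atrs eqxx.
(* Proportional lines span at most a line, against their independence at the common vertex. *)
have brs : b r \in <[b s]>%VS.
  apply/vlineP; exists (dot (l r) (l s) / dot (l s) (l s)); apply: hodge_inj.
  by rewrite hodgeZ -/(l r) -/(l s); exact: cross0_scale (line_neq0 s) crs.
have /dimvS : (<<[:: b r; b s]>> <= <[b s]>)%VS.
  apply/span_subvP => c; rewrite !inE => /orP[]/eqP-> //; exact: memv_line.
by rewrite dim_vline => + dE; rewrite dE; case: (b s != 0).
Qed.

Lemma line_triple r s t : uniq [:: r; s; t] -> dot (l r) (cross (l s) (l t)) != 0.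
Proof.
move=> urst; apply/negP => /eqP d0; apply: (b_gen urst).
exists (cross (l s) (l t)); rewrite !pairingE -/(l r) -/(l s) -/(l t) dotC d0.
rewrite dotC dot_crossl dotC dot_crossr line_pair //.
by move: urst; rewrite /= !inE => /and3P[].
Qed.

Lemma exists_minimally_rigid : exists p : V -> 'rV[R]_3,
  bar_joint_framework at_ p b /\ minimally_infinitesimally_rigid ends at_ p b.
Proof.
have dg : disjoint_on g setT.
  by move=> x y r _ _; rewrite !inE => /eqP<- /eqP.
have rl := sparse_realizable line_neq0 line_pair line_triple adj_sym adj_irr dg
  adj_sparse.
(* Distinctness of the points, as an open condition to be combined with rigidity. *)
pose P (q : V * V) (p : {ffun V -> 'rV[R]_3}) := (q.1 != q.2) -> cross (p q.1) (p q.2)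
  != 0.
have oP q : line_open (P q).
  exact/line_open_imply/line_open_vneq0/vregular_cross/vregular_coord/vregular_coord.
have g2 v : v \in [set: V] -> (#|g v| <= 2)%N by move=> _; exact: (cond1 v).1.
have [|q|p0 W0 P0] := line_open_all (@line_closed_on_lines _ _ _ l g setT) oP.
- by exists 0; exact: on_lines0.
- have [q12|q12] := eqVneq q.1 q.2.
    by exists 0; [exact: on_lines0 | rewrite /P q12 eqxx].
  have [p Wp pq] := generic_cross line_neq0 line_pair line_triple dg g2 (in_setT q.1)
    (in_setT q.2) q12.
  by exists p.
have [p [Wp [pn0 rp] Pp]] := realizable_generic (line_open_forall oP) rl (ex_intro2 _ _
  p0 W0 P0).
have p_neq0 v : p v != 0 by apply: pn0; rewrite inE.
exists p; split.
  split=> // [x y /= pxy|v r rv].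
    apply/eqP/negP => /negP xy; have := Pp (x, y) xy => /=.
    by rewrite (cross0_line_eq pxy) eqxx.
  by rewrite pairingE; apply: Wp; rewrite // inE.
apply: rigid_minimal => //; apply/infinitesimally_rigidE => // m [me ml] v.
apply: rp (in_setT v); split=> [x y _ _ /existsP[e]|u _ r ru].
  have := me e (in_setT e); rewrite pairingE hodge_wedge.
  move=> /[swap] /orP[]/eqP->//=.
  by rewrite crossC -opprB dotNl [dot _ (- _)]dotC dotNl dotC opprK.
by have := ml u r ru (in_setT r); rewrite pairingE.
Qed.

End Sufficiency.

Theorem theorem7p3 (R : realType) (V E I : finType)
    (ends : E -> V * V) (at_ : I -> V) (b : I -> 'rV[R]_3)
    (b_lines : forall r, represents_line (b r))
    (b_gen : general_position b) :
  (exists p : V -> 'rV[R]_3,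
      bar_joint_framework at_ p b /\
      minimally_infinitesimally_rigid ends at_ p b)
  <->
  [/\ forall v : V, (#|boundary_at at_ v| <= 2)%N /\
                    free [seq b r | r in boundary_at at_ v],
      forall F : {set E}, F != set0 ->
        (#|F| + #|boundary_of ends at_ F|)%:Z <=
          2 * #|edge_verts ends F|%:Z - 3
          + (\dim <<[seq b r | r in boundary_of ends at_ F]>>)%:Z
    & (#|E| + #|I| = 2 * #|V|)%N].
Proof.
split=> [[p [[p0 p_inj _ p_lines] rig]]|[c1 c2 c3]].
  split=> [v|F F0|].
  - split; first exact: minimal_boundary_card p0 p_lines rig v.
    exact: minimal_boundary_free rig v.
  - by have := minimal_sparse p0 p_inj p_lines rig F0; lia.
  - exact: minimal_card p0 p_lines rig.
apply: exists_minimally_rigid => // F F0.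
by have := c2 F F0; lia.
Qed.
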